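(* Let $C$ be a simple closed contour with bounded interior $\mathcal{D}^+$ and exterior $\mathcal{D}^-$, let $n\ge 1$ be an integer, and let $f$ be a generalized Cauchy function of order $n$ with respect to $C$. Suppose $f$ satisfies $$\frac{1}{2\pi i}\oint_C \frac{f(t)}{t-z}\,dt = f(z)\quad (z\in\mathcal{D}^+)\qquad\text{and also}\qquad \frac{1}{2\pi i}\oint_C \frac{f(t)}{t-z}\,dt = 0\quad (z\in\mathcal{D}^-),$$ and that $f^{(n)}$ is continuous on $C$. Then $f^{(n)}$ is uniformly continuous in the closed domain $\overline{\mathcal{D}^+}=\mathcal{D}^+\cup C$, and $$f^{(n)+}(z)=f^{(n)}(z),\qquad f^{(n)}(z)=\frac{1}{\pi i}\,\mathcal{P}\oint_C\frac{f^{(n)}(t)}{t-z}\,dt\qquad (z\in C).$$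
   Context: $C$ is a simple closed regular (smooth) curve in the complex plane, traversed counterclockwise; $\mathcal{D}^+$ is the simply connected open domain bounded by $C$, and $\mathcal{D}^-$ is the open domain outside $C$. A generalized Cauchy function of order $n$ with respect to $C$ is a single-valued function $f$ of the complex variable $z$ that is $n$ times continuously (complex) differentiable in $\mathcal{D}^+$ and in a neighborhood of $C$ (a neighborhood striding across $C$). For $z\in C$, $f^{(n)+}(z)$ denotes the limit of $f^{(n)}(z_+)$ as $z_+\in\mathcal{D}^+$ tends to $z$. The symbol $\mathcal{P}$ denotes the Cauchy principal value at $t=z$: the limit as $\epsilon\to 0^+$ of the integral over the part of $C$ with $|t-z|\ge\epsilon$. *)

(* Defs.v *)
From Stdlib Require Import Reals.
From Coquelicot Require Import Coquelicot.
Open Scope R_scope.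

Definition velocity (g : R -> C) (s : R) : C :=
  (Derive (fun u => Re (g u)) s, Derive (fun u => Im (g u)) s).

(* A closed curve is a [T]-periodic parametrization of the whole line, so that
   smoothness also holds at the base point [g 0 = g T].  "Regular (smooth)" is
   read as: continuously differentiable with nowhere vanishing velocity. *)
Record simple_closed_regular (g : R -> C) (T : R) : Prop := {
  scr_period : 0 < T;
  scr_closed : forall s, g (s + T) = g s;
  scr_simple : forall s u, 0 <= s < T -> 0 <= u < T -> g s = g u -> s = u;
  scr_derive : forall s, ex_derive (K := R_AbsRing) (V := C_R_NormedModule) g s;
  scr_C1 : forall s,
    continuous (T := R_UniformSpace) (U := C_UniformSpace) (velocity g) s;
  scr_regular : forall s, velocity g s <> RtoC 0 }.

Definition on_curve (g : R -> C) (T : R) (z : C) : Prop :=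
  exists s, 0 <= s <= T /\ g s = z.

(* [w] lies in the connected component of [z] in the complement of the curve;
   that complement is open, so components and path components coincide. *)
Definition joined_off_curve (g : R -> C) (T : R) (z w : C) : Prop :=
  exists p : R -> C,
    (forall s, continuous (T := R_UniformSpace) (U := C_UniformSpace) p s) /\
    p 0 = z /\ p 1 = w /\
    (forall s, 0 <= s <= 1 -> ~ on_curve g T (p s)).

Definition bounded_component (g : R -> C) (T : R) (z : C) : Prop :=
  exists M : R, forall w, joined_off_curve g T z w -> Cmod w <= M.

Definition interior_domain (g : R -> C) (T : R) (z : C) : Prop :=
  ~ on_curve g T z /\ bounded_component g T z.

Definition exterior_domain (g : R -> C) (T : R) (z : C) : Prop :=
  ~ on_curve g T z /\ ~ bounded_component g T z.

Definition closed_domain (g : R -> C) (T : R) (z : C) : Prop :=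
  interior_domain g T z \/ on_curve g T z.

Definition contour_RInt (g : R -> C) (T : R) (h : C -> C) : C :=
  RInt (V := C_R_CompleteNormedModule)
       (fun s => (h (g s) * velocity g s)%C) 0 T.

Definition winding_number (g : R -> C) (T : R) (z : C) : C :=
  (/ (RtoC (2 * PI) * Ci) * contour_RInt g T (fun t => / (t - z)))%C.

Definition counterclockwise (g : R -> C) (T : R) : Prop :=
  forall z, interior_domain g T z -> winding_number g T z = RtoC 1.

(* [l] is the limit, as [eps -> 0+], of the integral of [h] over the part of
   the curve where [eps <= |t - z|].  The use of [filterlimi] with [is_RInt]
   includes the existence of these integrals for all small [eps > 0]. *)
Definition is_contour_PV (g : R -> C) (T : R) (h : C -> C) (z l : C) : Prop :=
  filterlimi
    (fun (eps : R) (I : C) =>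
       is_RInt (V := C_R_NormedModule)
         (fun s => if Rle_dec eps (Cmod (g s - z))
                   then (h (g s) * velocity g s)%C else RtoC 0) 0 T I)
    (at_right 0) (locally (T := C_UniformSpace) l).

Fixpoint C_derive_n (f : C -> C) (n : nat) : C -> C :=
  match n with
  | O => f
  | S k => C_derive (C_derive_n f k)
  end.

(* Meaningful for open [U]; continuity of the derivatives of order less than
   [n] follows from their differentiability. *)
Definition n_times_C_differentiable (n : nat) (f : C -> C) (U : C -> Prop) :
    Prop :=
  (forall k z, (k < n)%nat -> U z ->
     ex_derive (K := C_AbsRing) (V := C_NormedModule) (C_derive_n f k) z) /\
  (forall z, U z ->
     continuous (T := C_UniformSpace) (U := C_UniformSpace) (C_derive_n f n) z).

(* The values of [f] outside the interior and the neighborhood [N] are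
   irrelevant. *)
Definition generalized_Cauchy_function (g : R -> C) (T : R) (n : nat)
    (f : C -> C) : Prop :=
  exists N : C -> Prop,
    open (T := C_UniformSpace) N /\
    (forall z, on_curve g T z -> N z) /\
    n_times_C_differentiable n f (fun z => interior_domain g T z \/ N z).

Definition uniformly_continuous_on (D : C -> Prop) (h : C -> C) : Prop :=
  forall eps : R, 0 < eps -> exists delta : R, 0 < delta /\
    forall z w, D z -> D w -> Cmod (z - w) < delta -> Cmod (h z - h w) < eps.

(* Main.v *)
Require Import Defs.
From Stdlib Require Import Reals Lra Lia ZArith Classical ClassicalEpsilon.
From Coquelicot Require Import Coquelicot.
Open Scope R_scope.

(** The Cauchy identities pass from [f] to its derivatives.  Off the curve a
    Cauchy integral may be differentiated under the integral sign, which turns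
    the kernel [1/(t-z)] into [1/(t-z)^2]; integrating by parts along the closed
    curve moves the derivative onto the density.  So if the Cauchy integral of
    [f] is [2 pi i f] inside and [0] outside, the same holds for [f'] as long as
    [f'] is continuous on the curve ([reproduced_derive]), and induction
    reaches [h = f^(n)].

    Uniform continuity and the boundary limit follow from the continuity of [h]
    at every point of the closed domain, which is compact: its complement is
    open, and points beyond the curve are in an unbounded component.

    The principal value is a jump computation that uses only the continuity of
    [h] on the curve and the Cauchy identities off it.  Fix [z = g s0], let [a] be the velocity there, and
    consider the two points [z + i a rho] and [z - i a rho] on the normal.  With
    [Y = (t - z)/a] the sum and the difference of the Cauchy kernels at these
    points are [(2/a) Y/(Y^2+rho^2)] and [(2i/a) rho/(Y^2+rho^2)], that is, the
    conjugate Poisson and the Poisson kernel of the tangent line, evaluated at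
    the complex argument [Y], which is [s - s0] up to a small relative error.
    Comparing with the line ([one_sided_limits], [two_sided_limits],
    [jump_on_curve]):
    - the difference of the two Cauchy integrals tends to [2 pi i] times the
      density at [z];
    - their sum differs by [o(1)] from twice the Cauchy integral truncated at
      [|t - z| >= |a| rho].

    The first fact for the density [1] says that the winding numbers of the two
    points differ by about [1].  The winding number is [1] inside by the
    orientation and [0] outside ([winding_exterior]), so the left point is
    inside and the right point outside ([sides_of_curve]); this replaces the
    Jordan curve theorem.  By the second fact, twice the truncated integral of
    [h(t)/(t-z)] is then close to [2 pi i h(z + i a rho) + 0], which tends to
    [2 pi i h(z)]. *)

(** * Complex-valued functions: continuity, derivatives, integrals *)

(** The letters record the domain and the codomain.  Functions of a real
    variable use the real normed-module structure of [C], functions of a complex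
    variable the complex one; the two structures have the same neighborhoods and
    the same norm [Cmod], but are not convertible. *)

Local Notation contRC := (continuous (T := R_UniformSpace) (U := C_UniformSpace)).
Local Notation contCC := (continuous (T := C_UniformSpace) (U := C_UniformSpace)).
Local Notation derRC := (is_derive (K := R_AbsRing) (V := C_R_NormedModule)).
Local Notation derCC := (is_derive (K := C_AbsRing) (V := C_NormedModule)).
Local Notation intRC := (is_RInt (V := C_R_NormedModule)).

Lemma locally_Cmod (z : C) (P : C -> Prop) :
  locally (T := C_UniformSpace) z P <->
  exists d, 0 < d /\ forall w, Cmod (w - z) < d -> P w.
Proof.
split.
- intros H.
  destruct (locally_norm_le_locally (V := C_NormedModule) z P H) as [d Hd].
  exists d; split; [apply cond_pos | intros w Hw; apply Hd; exact Hw].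
- intros [d [Hd H]].
  apply (locally_le_locally_norm (V := C_NormedModule) z P).
  exists (mkposreal d Hd). intros w Hw; apply H; exact Hw.
Qed.

Lemma locally_Rabs (x : R) (P : R -> Prop) :
  locally x P <-> exists d, 0 < d /\ forall y, Rabs (y - x) < d -> P y.
Proof.
split.
- intros [d Hd]. exists d; split; [apply cond_pos | intros w Hw; apply Hd; exact Hw].
- intros [d [Hd H]]. exists (mkposreal d Hd). intros w Hw; apply H; exact Hw.
Qed.

Lemma contCC_eps (h : C -> C) (z : C) :
  contCC h z <-> forall e, 0 < e -> exists d, 0 < d /\
    forall w, Cmod (w - z) < d -> Cmod (h w - h z) < e.
Proof.
split.
- intros H e He.
  apply locally_Cmod. apply (H (fun y => Cmod (y - h z) < e)).
  apply locally_Cmod. exists e; split; auto.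
- intros H P HP. apply locally_Cmod in HP. destruct HP as [e [He HP]].
  apply locally_Cmod. destruct (H e He) as [d [Hd Hd']].
  exists d; split; auto.
Qed.

Lemma contRC_eps (h : R -> C) (x : R) :
  contRC h x <-> forall e, 0 < e -> exists d, 0 < d /\
    forall y, Rabs (y - x) < d -> Cmod (h y - h x) < e.
Proof.
split.
- intros H e He.
  apply locally_Rabs. apply (H (fun y => Cmod (y - h x) < e)).
  apply locally_Cmod. exists e; split; auto.
- intros H P HP. apply locally_Cmod in HP. destruct HP as [e [He HP]].
  apply (locally_Rabs x). destruct (H e He) as [d [Hd Hd']].
  exists d; split; auto.
Qed.

Lemma contRC_pair (f : R -> C) (x : R) :
  contRC f x <->
  continuous (fun s => Re (f s)) x /\ continuous (fun s => Im (f s)) x.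
Proof.
split.
- intros H; split.
  + apply (continuous_comp f Re x H). destruct (f x). apply continuous_fst.
  + apply (continuous_comp f Im x H). destruct (f x). apply continuous_snd.
- intros [H1 H2] P [d HP].
  assert (A : locally x (fun y => ball (Re (f x)) d (Re (f y)))).
  { apply H1. apply locally_ball. }
  assert (B : locally x (fun y => ball (Im (f x)) d (Im (f y)))).
  { apply H2. apply locally_ball. }
  generalize (filter_and _ _ A B). apply (filter_imp (F := locally x)).
  intros y [U V]. apply HP. split; [exact U | exact V].
Qed.

Lemma contRC_const (c : C) x : contRC (fun _ => c) x.
Proof. apply continuous_const. Qed.

Lemma contRC_plus (f h : R -> C) x :
  contRC f x -> contRC h x -> contRC (fun s => f s + h s)%C x.
Proof. exact (continuous_plus (V := C_R_NormedModule) f h x). Qed.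

Lemma contRC_minus (f h : R -> C) x :
  contRC f x -> contRC h x -> contRC (fun s => f s - h s)%C x.
Proof. exact (continuous_minus (V := C_R_NormedModule) f h x). Qed.

Lemma contRC_mult (f h : R -> C) x :
  contRC f x -> contRC h x -> contRC (fun s => f s * h s)%C x.
Proof.
rewrite !contRC_pair. intros [A B] [A' B']; split; simpl.
- apply (continuous_minus (V := R_NormedModule)); apply (continuous_mult (K := R_AbsRing)); assumption.
- apply (continuous_plus (V := R_NormedModule)); apply (continuous_mult (K := R_AbsRing)); assumption.
Qed.

Lemma Cnorm2_pos (z : C) : z <> 0 -> 0 < fst z ^ 2 + snd z ^ 2.
Proof.
intros H. destruct z as [x y]; simpl.
destruct (Req_dec x 0) as [->|Hx]; [|nra].
destruct (Req_dec y 0) as [->|Hy]; [|nra]. now elim H.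
Qed.

Lemma contRC_inv (f : R -> C) x :
  contRC f x -> f x <> 0 -> contRC (fun s => / f s)%C x.
Proof.
rewrite !contRC_pair. intros [A B] H. pose proof (Cnorm2_pos _ H) as HN.
assert (D : continuous (fun s => / (fst (f s) ^ 2 + snd (f s) ^ 2)) x).
{ apply continuous_Rinv_comp; [|lra]. simpl.
  apply (continuous_plus (V := R_NormedModule));
  repeat apply (continuous_mult (K := R_AbsRing)); try assumption; apply continuous_const. }
split; simpl.
- apply (continuous_mult (K := R_AbsRing)); assumption.
- apply (continuous_mult (K := R_AbsRing)); [apply (continuous_opp (V := R_NormedModule))|]; assumption.
Qed.

Lemma contRC_Cmod (f : R -> C) x : contRC f x -> continuous (fun s => Cmod (f s)) x.
Proof.
intros H. apply (continuous_comp (V := C_UniformSpace) f Cmod x H).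
exact (filterlim_norm (V := C_NormedModule) (f x)).
Qed.

Lemma derRC_pair (f : R -> C) x (l : C) :
  derRC f x l <->
  is_derive (fun s => Re (f s)) x (Re l) /\ is_derive (fun s => Im (f s)) x (Im l).
Proof.
split.
- intros H; split.
  + apply (filterdiff_comp f Re (fun y => scal y l) Re H).
    apply filterdiff_linear, is_linear_fst.
  + apply (filterdiff_comp f Im (fun y => scal y l) Im H).
    apply filterdiff_linear, is_linear_snd.
- intros [H1 H2].
  assert (L : filterdiff (U := prod_NormedModule R_AbsRing R_NormedModule R_NormedModule)
     (V := C_R_NormedModule) (fun t => (fst t, snd t))
     (filtermap (fun t => (Re (f t), Im (f t))) (locally x)) (fun t => (fst t, snd t))).
  { apply filterdiff_linear. split.
    - intros a b. reflexivity.
    - intros k a. reflexivity.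
    - exists 1. split; [lra|]. intros [a b]. rewrite Rmult_1_l. apply Rle_refl. }
  assert (H := filterdiff_comp_2 (K := R_AbsRing) (fun s => Re (f s)) (fun s => Im (f s))
     (fun a b => (a, b) : C_R_NormedModule) (fun y => scal y (Re l)) (fun y => scal y (Im l))
     (fun a b => (a, b) : C_R_NormedModule) H1 H2 L).
  eapply filterdiff_ext_lin; [eapply filterdiff_ext; [|apply H]|].
  + intros y; simpl. unfold Re, Im. now destruct (f y).
  + intros y; simpl. destruct l; reflexivity.
Qed.

Lemma derRC_mult (f h : R -> C) x (lf lh : C) :
  derRC f x lf -> derRC h x lh ->
  derRC (fun s => f s * h s)%C x (lf * h x + f x * lh)%C.
Proof.
rewrite !derRC_pair. intros [A B] [A' B']; split.
- apply (is_derive_ext (fun s => Re (f s) * Re (h s) - Im (f s) * Im (h s))).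
  { reflexivity. }
  replace (Re (lf * h x + f x * lh)%C) with
    ((Re lf * Re (h x) + Re (f x) * Re lh) - (Im lf * Im (h x) + Im (f x) * Im lh))
    by (simpl; unfold Re, Im; ring).
  apply (is_derive_minus (V := R_NormedModule)); apply (is_derive_mult (K := R_AbsRing)); try assumption;
   exact Rmult_comm.
- apply (is_derive_ext (fun s => Re (f s) * Im (h s) + Im (f s) * Re (h s))).
  { reflexivity. }
  replace (Im (lf * h x + f x * lh)%C) with
    ((Re lf * Im (h x) + Re (f x) * Im lh) + (Im lf * Re (h x) + Im (f x) * Re lh))
    by (simpl; unfold Re, Im; ring).
  apply (is_derive_plus (V := R_NormedModule)); apply (is_derive_mult (K := R_AbsRing)); try assumption;
   exact Rmult_comm.
Qed.

Lemma derRC_const (c : C) x : derRC (fun _ => c) x (RtoC 0).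
Proof. exact (is_derive_const (V := C_R_NormedModule) c x). Qed.

Lemma derRC_minus (f h : R -> C) x (lf lh : C) :
  derRC f x lf -> derRC h x lh -> derRC (fun s => f s - h s)%C x (lf - lh)%C.
Proof. exact (is_derive_minus (V := C_R_NormedModule) f h x lf lh). Qed.

Lemma contRC_of_derRC (f : R -> C) x l : derRC f x l -> contRC f x.
Proof.
intros H. apply (ex_derive_continuous (V := C_R_NormedModule)). now exists l.
Qed.

Lemma derRC_inv (f : R -> C) x (l : C) :
  derRC f x l -> f x <> 0 -> derRC (fun s => / f s)%C x (- l / (f x * f x))%C.
Proof.
rewrite !derRC_pair. intros [A B] H. pose proof (Cnorm2_pos _ H) as HN.
assert (D : is_derive (fun s => / (Re (f s) ^ 2 + Im (f s) ^ 2)) x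
  (- (2 * Re (f x) * Re l + 2 * Im (f x) * Im l) / (Re (f x) ^ 2 + Im (f x) ^ 2) ^ 2)).
{ apply (is_derive_inv (fun s => Re (f s) ^ 2 + Im (f s) ^ 2)); [|unfold Re, Im; lra].
  replace (2 * Re (f x) * Re l + 2 * Im (f x) * Im l) with
   (Re l * Re (f x) + Re (f x) * Re l + (Im l * Im (f x) + Im (f x) * Im l)) by ring.
  apply (is_derive_plus (V := R_NormedModule)).
  - apply (is_derive_ext (fun s => Re (f s) * Re (f s))).
    { intros t. change (Re (f t) * Re (f t) = Re (f t) ^ 2). ring. }
    apply (is_derive_mult (K := R_AbsRing)); try assumption; exact Rmult_comm.
  - apply (is_derive_ext (fun s => Im (f s) * Im (f s))).
    { intros t. change (Im (f t) * Im (f t) = Im (f t) ^ 2). ring. }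
    apply (is_derive_mult (K := R_AbsRing)); try assumption; exact Rmult_comm. }
split.
- assert (E := is_derive_mult (K := R_AbsRing) _ _ x _ _ A D Rmult_comm).
  eapply is_derive_ext in E; [|intros; reflexivity].
  replace (Re (- l / (f x * f x))%C) with
   (plus (mult (Re l) (/ (Re (f x) ^ 2 + Im (f x) ^ 2)))
    (mult (Re (f x)) (- (2 * Re (f x) * Re l + 2 * Im (f x) * Im l) / (Re (f x) ^ 2 + Im (f x) ^ 2) ^ 2))).
  { exact E. }
  revert HN. destruct (f x) as [u v], l as [p q]. cbn -[pow]. unfold Re, Im; cbn -[pow]. intros. unfold plus, mult; cbn -[pow]. field.
  split. nra. nra.
- assert (E := is_derive_mult (K := R_AbsRing) _ _ x _ _ (is_derive_opp _ _ _ B) D Rmult_comm).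
  eapply is_derive_ext in E; [|intros; reflexivity].
  replace (Im (- l / (f x * f x))%C) with
   (plus (mult (opp (Im l)) (/ (Re (f x) ^ 2 + Im (f x) ^ 2)))
    (mult (opp (Im (f x))) (- (2 * Re (f x) * Re l + 2 * Im (f x) * Im l) / (Re (f x) ^ 2 + Im (f x) ^ 2) ^ 2))).
  { exact E. }
  revert HN. destruct (f x) as [u v], l as [p q]. cbn -[pow]. unfold Re, Im; cbn -[pow]. intros. unfold plus, mult, opp; cbn -[pow]. field.
  split. nra. nra.
Qed.

(** A complex differential is in particular a real-linear one with the same
    remainder, so the chain rule for real differentials applies. *)
Lemma derRC_comp (f : C -> C) (p : R -> C) x (l v : C) :
  derCC f (p x) l -> derRC p x v -> derRC (fun s => f (p s)) x (l * v)%C.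
Proof.
intros [_ Hf] Hp.
assert (L : filterdiff (K := R_AbsRing) (U := C_R_NormedModule) (V := C_R_NormedModule) f
     (locally (p x)) (fun y => (y * l)%C)).
{ split.
  - split.
    + intros a b. exact (Cmult_plus_distr_r a b l).
    + intros k [a b]. destruct l as [c d]. unfold scal; simpl.
      unfold prod_scal, scal, Cmult; simpl. unfold mult; simpl. f_equal; ring.
    + exists (Cmod l + 1). split. { pose proof (Cmod_ge_0 l); lra. }
      intros a. rewrite <- !Cmod_norm, Cmod_mult.
      pose proof (Cmod_ge_0 l). pose proof (Cmod_ge_0 a). nra.
  - intros z Hz eps.
    rewrite <- (is_filter_lim_locally_unique (V := C_R_NormedModule) (p x) z Hz).
    assert (D := Hf (p x) (fun P H => H) eps). apply locally_C in D.
    revert D. apply (filter_imp (F := locally (T := C_UniformSpace) (p x))).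
    intros y Hy. rewrite <- !Cmod_norm. exact Hy. }
assert (H := filterdiff_comp' _ _ _ _ _ Hp L).
eapply filterdiff_ext_lin; [exact H|].
intros y. destruct v as [a b], l as [c d]. unfold scal; simpl.
unfold prod_scal, scal, Cmult; simpl. unfold mult; simpl. f_equal; ring.
Qed.

Lemma intRC_pair (f : R -> C) a b (l : C) :
  intRC f a b l <->
  is_RInt (fun s => Re (f s)) a b (Re l) /\ is_RInt (fun s => Im (f s)) a b (Im l).
Proof.
split.
- intros H; split; [exact (is_RInt_fct_extend_fst f a b l H) | exact (is_RInt_fct_extend_snd f a b l H)].
- intros [A B]. destruct l as [u v]. exact (is_RInt_fct_extend_pair f a b u v A B).
Qed.

Lemma intRC_scal (c : C) (f : R -> C) a b (l : C) :
  intRC f a b l -> intRC (fun s => c * f s)%C a b (c * l)%C.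
Proof.
rewrite !intRC_pair. intros [A B]. destruct c as [p q]. split; cbn.
- apply (is_RInt_minus (V := R_NormedModule)); apply (is_RInt_scal (V := R_NormedModule)); assumption.
- apply (is_RInt_plus (V := R_NormedModule)); apply (is_RInt_scal (V := R_NormedModule)); assumption.
Qed.

Lemma intRC_plus (f h : R -> C) a b (lf lh : C) :
  intRC f a b lf -> intRC h a b lh -> intRC (fun s => f s + h s)%C a b (lf + lh)%C.
Proof. exact (is_RInt_plus (V := C_R_NormedModule) f h a b lf lh). Qed.

Lemma intRC_minus (f h : R -> C) a b (lf lh : C) :
  intRC f a b lf -> intRC h a b lh -> intRC (fun s => f s - h s)%C a b (lf - lh)%C.
Proof. exact (is_RInt_minus (V := C_R_NormedModule) f h a b lf lh). Qed.

Lemma intRC_unique (f : R -> C) a b (l l' : C) :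
  intRC f a b l -> intRC f a b l' -> l = l'.
Proof.
intros H H'. rewrite <- (is_RInt_unique (V := C_R_CompleteNormedModule) f a b l H).
exact (is_RInt_unique (V := C_R_CompleteNormedModule) f a b l' H').
Qed.

Lemma intRC_bound (f : R -> C) (m : R -> R) a b (l : C) (lm : R) :
  a <= b -> (forall s, a <= s <= b -> Cmod (f s) <= m s) ->
  intRC f a b l -> is_RInt m a b lm -> Cmod l <= lm.
Proof.
intros Hab H Hf Hm. rewrite Cmod_norm.
apply (norm_RInt_le (V := C_R_NormedModule) f m a b l lm Hab); auto.
intros s Hs. apply Rle_trans with (Cmod (f s)); [|auto].
apply Req_le; symmetry; exact (Cmod_norm (f s)).
Qed.

Lemma intRC_bound_const (f : R -> C) (m : R) a b (l : C) :
  a <= b -> (forall s, a <= s <= b -> Cmod (f s) <= m) ->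
  intRC f a b l -> Cmod l <= (b - a) * m.
Proof.
intros Hab H Hf. apply (intRC_bound f (fun _ => m) a b l); auto.
exact (is_RInt_const (V := R_NormedModule) a b m).
Qed.

Lemma intRC_cont (f : R -> C) a b :
  (forall s, Rmin a b <= s <= Rmax a b -> contRC f s) ->
  intRC f a b (RInt (V := C_R_CompleteNormedModule) f a b).
Proof.
intros H. apply (RInt_correct (V := C_R_CompleteNormedModule)).
apply (ex_RInt_continuous (V := C_R_CompleteNormedModule)). exact H.
Qed.

Lemma intRC_FTC (f df : R -> C) a b :
  (forall s, Rmin a b <= s <= Rmax a b -> derRC f s (df s)) ->
  (forall s, Rmin a b <= s <= Rmax a b -> contRC df s) ->
  intRC df a b (f b - f a)%C.
Proof. exact (is_RInt_derive (V := C_R_CompleteNormedModule) f df a b). Qed.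

Lemma intRC_ext (f h : R -> C) a b (l : C) :
  a <= b -> (forall s, a < s < b -> f s = h s) -> intRC f a b l -> intRC h a b l.
Proof.
intros Hab H. apply (is_RInt_ext (V := C_R_NormedModule)).
rewrite Rmin_left, Rmax_right by lra. exact H.
Qed.

Lemma intRC_zero a b : intRC (fun _ => RtoC 0) a b (RtoC 0).
Proof.
assert (Z := intRC_FTC (fun _ => RtoC 1) (fun _ => RtoC 0) a b
  (fun s _ => derRC_const _ s) (fun s _ => contRC_const _ s)).
cbv beta in Z. replace (RtoC 1 - RtoC 1)%C with (RtoC 0) in Z by ring. exact Z.
Qed.

(** * The curve and its Cauchy integrals *)

Lemma continuous_bounded_above (f : R -> R) a b :
  a <= b -> (forall s, a <= s <= b -> continuous f s) ->
  exists M, forall s, a <= s <= b -> f s <= M.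
Proof.
intros Hab H. destruct (continuity_ab_maj f a b Hab) as [m [Hm _]].
- intros s Hs. apply continuity_pt_filterlim. exact (H s Hs).
- now exists (f m).
Qed.

Lemma continuous_pos_bounded_below (f : R -> R) a b :
  a <= b -> (forall s, a <= s <= b -> continuous f s) ->
  (forall s, a <= s <= b -> 0 < f s) ->
  exists m, 0 < m /\ forall s, a <= s <= b -> m <= f s.
Proof.
intros Hab H Hp. destruct (continuity_ab_min f a b Hab) as [m [Hm Hm']].
- intros s Hs. apply continuity_pt_filterlim. exact (H s Hs).
- exists (f m); auto.
Qed.

Lemma contRC_bounded (f : R -> C) a b :
  a <= b -> (forall s, a <= s <= b -> contRC f s) ->
  exists M, 0 < M /\ forall s, a <= s <= b -> Cmod (f s) <= M.
Proof.
intros Hab H.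
destruct (continuous_bounded_above (fun s => Cmod (f s)) a b Hab) as [M HM].
{ intros; apply contRC_Cmod; auto. }
exists (Rmax M 1). split. { pose proof (Rmax_r M 1); lra. }
intros s Hs. eapply Rle_trans; [exact (HM s Hs) | apply Rmax_l].
Qed.

Lemma im_le_Cmod (z : C) : Rabs (Im z) <= Cmod z.
Proof. eapply Rle_trans; [apply Rmax_r | apply Rmax_Cmod]. Qed.

Lemma Cminus_neq_0 (a b : C) : a <> b -> (a - b)%C <> 0.
Proof. intros H E. apply H. replace a with (a - b + b)%C by ring. rewrite E; ring. Qed.

Lemma Cmod_pos_neq_0 (a : C) : 0 < Cmod a -> a <> 0.
Proof. intros H ->. rewrite Cmod_0 in H. lra. Qed.

Lemma Cmod_minus_comm (a b : C) : Cmod (a - b) = Cmod (b - a).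
Proof. rewrite <- Cmod_opp. f_equal. ring. Qed.

Lemma Cmod_triangle_sub (a b : C) : Cmod a - Cmod b <= Cmod (a - b).
Proof.
pose proof (Cmod_triangle (a - b) b) as H.
replace (a - b + b)%C with a in H by ring. lra.
Qed.

Lemma Cmod_triangle_minus (a b : C) : Cmod (a - b) <= Cmod a + Cmod b.
Proof.
pose proof (Cmod_triangle a (- b)) as H. rewrite Cmod_opp in H. exact H.
Qed.

Lemma derRC_curve g T : simple_closed_regular g T -> forall s, derRC g s (velocity g s).
Proof.
intros Hc s. destruct (scr_derive _ _ Hc s) as [l Hl].
replace (velocity g s) with l; [exact Hl|].
apply derRC_pair in Hl. destruct Hl as [A B]. unfold velocity.
apply injective_projections; simpl; symmetry; apply is_derive_unique; assumption.
Qed.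

Lemma contRC_curve g T : simple_closed_regular g T -> forall s, contRC g s.
Proof. intros Hc s. eapply contRC_of_derRC, derRC_curve; eauto. Qed.

Lemma curve_endpoints g T : simple_closed_regular g T -> g T = g 0.
Proof. intros Hc. rewrite <- (scr_closed _ _ Hc 0). f_equal; ring. Qed.

Lemma off_curve_dist g T w : simple_closed_regular g T -> ~ on_curve g T w ->
  exists d, 0 < d /\ forall s, 0 <= s <= T -> d <= Cmod (g s - w).
Proof.
intros Hc Hw. apply continuous_pos_bounded_below.
- pose proof (scr_period _ _ Hc); lra.
- intros s _. apply contRC_Cmod, contRC_minus; [eapply contRC_curve; eauto | apply contRC_const].
- intros s Hs. apply Cmod_gt_0, Cminus_neq_0. intros E. apply Hw. now exists s.
Qed.

Lemma dist_off_curve g T w d : 0 < d ->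
  (forall s, 0 <= s <= T -> d <= Cmod (g s - w)) ->
  forall w', Cmod (w' - w) < d -> ~ on_curve g T w'.
Proof.
intros Hd H w' Hw' [s [Hs E]]. specialize (H s Hs). rewrite E in H. lra.
Qed.

(** The density is a function of the parameter and includes the velocity
    factor, so that integration by parts and periodicity concern functions of a
    real variable only. *)
Definition cauchy_integral (g : R -> C) (T : R) (phi : R -> C) (w : C) : C :=
  RInt (V := C_R_CompleteNormedModule) (fun s => phi s / (g s - w))%C 0 T.

(** Kernel expansions give quadratic remainders, whose domination by every
    multiple of the increment is settled here once and for all. *)
Lemma derCC_of_quadratic (F : C -> C) (w l : C) (K d : R) : 0 < d ->
  (forall w', Cmod (w' - w) < d ->
     Cmod (F w' - F w - l * (w' - w)) <= K * Cmod (w' - w) ^ 2) ->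
  derCC F w l.
Proof.
intros Hd H. split. { apply is_linear_scal_l. }
intros z Hz eps.
rewrite <- (is_filter_lim_locally_unique (V := AbsRing_NormedModule C_AbsRing) w z Hz).
apply locally_C, locally_Cmod.
set (K' := Rabs K + 1). assert (0 < K') by (unfold K'; pose proof (Rabs_pos K); lra).
exists (Rmin d (eps / K')). split.
{ apply Rmin_pos; [lra|]. apply Rdiv_lt_0_compat; [apply cond_pos | lra]. }
intros w' Hw'.
change (Cmod (F w' - F w - (w' - w) * l) <= eps * Cmod (w' - w)).
rewrite (Cmult_comm (w' - w) l).
eapply Rle_trans. { apply H. eapply Rlt_le_trans; [exact Hw' | apply Rmin_l]. }
assert (A : Cmod (w' - w) < eps / K'). { eapply Rlt_le_trans; [exact Hw' | apply Rmin_r]. }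
pose proof (Cmod_ge_0 (w' - w)) as P.
apply Rle_trans with (K' * Cmod (w' - w) ^ 2).
- apply Rmult_le_compat_r; [nra|]. unfold K'. pose proof (Rle_abs K). lra.
- replace (pos eps) with (K' * (eps / K')) by (field; lra).
  rewrite Rmult_assoc. apply Rmult_le_compat_l; [lra|].
  simpl. rewrite Rmult_1_r. apply Rmult_le_compat_r; lra.
Qed.

Lemma contRC_cauchy_kernel (phi g : R -> C) w s :
  contRC phi s -> contRC g s -> g s <> w -> contRC (fun s => phi s / (g s - w))%C s.
Proof.
intros A B D. apply contRC_mult; [exact A|]. apply contRC_inv.
- apply contRC_minus; [exact B | apply contRC_const].
- now apply Cminus_neq_0.
Qed.

Lemma contRC_cauchy_kernel2 (phi g : R -> C) w s :
  contRC phi s -> contRC g s -> g s <> w ->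
  contRC (fun s => phi s / ((g s - w) * (g s - w)))%C s.
Proof.
intros A B D. pose proof (Cminus_neq_0 _ _ D). apply contRC_mult; [exact A|]. apply contRC_inv.
- apply contRC_mult; (apply contRC_minus; [exact B | apply contRC_const]).
- now apply Cmult_neq_0.
Qed.

Lemma cauchy_integral_correct g T phi w : 0 <= T ->
  (forall s, 0 <= s <= T -> contRC g s) -> (forall s, 0 <= s <= T -> contRC phi s) ->
  ~ on_curve g T w ->
  intRC (fun s => phi s / (g s - w))%C 0 T (cauchy_integral g T phi w).
Proof.
intros HT Hg Hphi Hw. apply intRC_cont. rewrite Rmin_left, Rmax_right by lra.
intros s Hs. apply contRC_cauchy_kernel; auto.
intros E. apply Hw. now exists s.
Qed.

(** Differentiation under the integral sign, from the exact identity
    [1/(t-w') - 1/(t-w) - (w'-w)/(t-w)^2 = (w'-w)^2/((t-w)^2 (t-w'))] and the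
    positive distance of [w] to the curve. *)
Lemma cauchy_integral_derive g T phi w :
  simple_closed_regular g T -> (forall s, 0 <= s <= T -> contRC phi s) ->
  ~ on_curve g T w ->
  forall J, intRC (fun s => phi s / ((g s - w) * (g s - w)))%C 0 T J ->
  derCC (cauchy_integral g T phi) w J.
Proof.
intros Hc Hphi Hw J HJ. pose proof (scr_period _ _ Hc) as HT.
assert (Hg : forall s, 0 <= s <= T -> contRC g s) by (intros; eapply contRC_curve; eauto).
destruct (off_curve_dist g T w Hc Hw) as [d [Hd Hdist]].
destruct (contRC_bounded phi 0 T) as [M [HM HMb]]; auto; [lra|].
apply derCC_of_quadratic with (K := T * (2 * M / d ^ 3)) (d := d / 2); [lra|].
intros w' Hw'.
assert (Hoff : ~ on_curve g T w').
{ apply dist_off_curve with (1 := Hd) (2 := Hdist). lra. }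
assert (I1 := cauchy_integral_correct g T phi w (Rlt_le _ _ HT) Hg Hphi Hw).
assert (I2 := cauchy_integral_correct g T phi w' (Rlt_le _ _ HT) Hg Hphi Hoff).
assert (I := intRC_minus _ _ _ _ _ _ (intRC_minus _ _ _ _ _ _ I2 I1) (intRC_scal (w' - w) _ _ _ _ HJ)).
rewrite (Cmult_comm J).
replace (T * (2 * M / d ^ 3) * Cmod (w' - w) ^ 2) with
  ((T - 0) * (2 * M / d ^ 3 * Cmod (w' - w) ^ 2)) by ring.
refine (intRC_bound_const _ _ _ _ _ (Rlt_le _ _ HT) _ I).
intros s Hs. specialize (Hdist s Hs). specialize (HMb s Hs).
assert (Hd2 : d / 2 <= Cmod (g s - w')).
{ pose proof (Cmod_triangle_sub (g s - w) (w' - w)) as A.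
  replace (g s - w - (w' - w))%C with (g s - w')%C in A by ring. lra. }
assert (N1 : (g s - w)%C <> 0) by (apply Cmod_pos_neq_0; lra).
assert (N2 : (g s - w')%C <> 0) by (apply Cmod_pos_neq_0; lra).
replace (phi s / (g s - w') - phi s / (g s - w) - (w' - w) * (phi s / ((g s - w) * (g s - w))))%C
 with (phi s * ((w' - w) * (w' - w)) / ((g s - w) * (g s - w) * (g s - w')))%C.
2: { field. split; assumption. }
rewrite Cmod_div by (repeat apply Cmult_neq_0; assumption). rewrite !Cmod_mult.
set (a := Cmod (g s - w)) in *. set (b := Cmod (g s - w')) in *. set (k := Cmod (w' - w)).
pose proof (Cmod_ge_0 (phi s)). pose proof (Cmod_ge_0 (w' - w)). fold k in H0.
replace (2 * M / d ^ 3 * k ^ 2) with (M * (k * k) * / (d * d * (d / 2))) by (field; lra).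
unfold Rdiv at 1. apply Rmult_le_compat.
- nra.
- apply Rlt_le, Rinv_0_lt_compat. apply Rmult_lt_0_compat; nra.
- apply Rmult_le_compat_r; nra.
- apply Rinv_le_contravar; [apply Rmult_lt_0_compat; nra|].
  apply Rmult_le_compat; nra.
Qed.

Lemma derRC_over_linear (p g : R -> C) s w dp dg :
  derRC p s dp -> derRC g s dg -> g s <> w ->
  derRC (fun s => p s / (g s - w))%C s
    (dp / (g s - w) - p s * dg / ((g s - w) * (g s - w)))%C.
Proof.
intros A B D. pose proof (Cminus_neq_0 _ _ D) as N.
assert (E := derRC_mult _ _ _ _ _ A
  (derRC_inv _ _ _ (derRC_minus _ _ _ _ _ B (derRC_const w s)) N)).
replace (dp / (g s - w) - p s * dg / ((g s - w) * (g s - w)))%C with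
  (dp * / (g s - w) + p s * (- (dg - 0) / ((g s - w) * (g s - w))))%C; [exact E|].
field. exact N.
Qed.

(** The function [p/(g - w)] takes the same value at both ends of the period, so
    the integral of its derivative vanishes. *)
Lemma cauchy_by_parts g T (p dp : R -> C) w :
  simple_closed_regular g T -> ~ on_curve g T w ->
  (forall s, 0 <= s <= T -> derRC p s (dp s)) ->
  (forall s, 0 <= s <= T -> contRC dp s) -> p T = p 0 ->
  intRC (fun s => p s * velocity g s / ((g s - w) * (g s - w)))%C 0 T
    (cauchy_integral g T dp w).
Proof.
intros Hc Hw Hp Hdp E. pose proof (scr_period _ _ Hc) as HT.
assert (N : forall s, 0 <= s <= T -> g s <> w) by (intros s Hs F; apply Hw; now exists s).
assert (I1 := cauchy_integral_correct g T dp w (Rlt_le _ _ HT)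
  (fun s _ => contRC_curve g T Hc s) Hdp Hw).
assert (I2 : intRC (fun s => dp s / (g s - w) - p s * velocity g s / ((g s - w) * (g s - w)))%C 0 T
   (p T / (g T - w) - p 0 / (g 0 - w))%C).
{ apply (intRC_FTC (fun s => p s / (g s - w))%C); rewrite Rmin_left, Rmax_right by lra; intros s Hs.
  - apply derRC_over_linear; auto. now apply (derRC_curve g T).
  - apply contRC_minus.
    + apply contRC_cauchy_kernel; auto. now apply (contRC_curve g T).
    + apply contRC_cauchy_kernel2 with (phi := fun s => (p s * velocity g s)%C); auto.
      * apply contRC_mult; [eapply contRC_of_derRC; eauto | exact (scr_C1 g T Hc s)].
      * now apply (contRC_curve g T). }
assert (I := intRC_minus _ _ _ _ _ _ I1 I2). cbv beta in I.
rewrite E, (curve_endpoints g T Hc) in I.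
replace (cauchy_integral g T dp w - (p 0 / (g 0 - w) - p 0 / (g 0 - w)))%C
  with (cauchy_integral g T dp w) in I by ring.
apply (intRC_ext) with (3 := I); [lra|].
intros s _. ring.
Qed.

(** * Components of the complement and the winding number *)

Lemma segment_joined g T z w :
  (forall s, 0 <= s <= 1 -> ~ on_curve g T (z + s * (w - z))%C) ->
  joined_off_curve g T z w.
Proof.
intros H. exists (fun s => z + s * (w - z))%C. repeat split.
- intros s. apply contRC_plus; [apply contRC_const|]. apply contRC_mult; [|apply contRC_const].
  apply contRC_pair. split; simpl; [apply continuous_id | apply continuous_const].
- ring.
- ring.
- exact H.
Qed.

(** The concatenated path is [p (min (2s) 1) + q (max (2s-1) 0) - y]: one of the
    first two terms equals [y] at any time, and continuity is immediate. *)
Lemma joined_trans g T x y z :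
  joined_off_curve g T x y -> joined_off_curve g T y z -> joined_off_curve g T x z.
Proof.
intros [p [Cp [P0 [P1 Hp]]]] [q [Cq [Q0 [Q1 Hq]]]].
exists (fun s => p (Rmin (2 * s) 1) + q (Rmax (2 * s - 1) 0) - y)%C.
assert (A : forall s, 0 <= s <= 1 ->
  (exists u, 0 <= u <= 1 /\ (p (Rmin (2 * s) 1) + q (Rmax (2 * s - 1) 0) - y)%C = p u) \/
  (exists u, 0 <= u <= 1 /\ (p (Rmin (2 * s) 1) + q (Rmax (2 * s - 1) 0) - y)%C = q u)).
{ intros s Hs. destruct (Rle_dec (2 * s) 1) as [L|L].
  - left. exists (2 * s). split; [lra|]. rewrite Rmin_left, Rmax_right by lra. rewrite Q0. ring.
  - right. exists (2 * s - 1). split; [lra|]. rewrite Rmin_right, Rmax_left by lra. rewrite P1. ring. }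
assert (Cmin : forall s, continuous (fun s => Rmin (2 * s) 1) s).
{ intros s. apply (continuous_ext (fun s => (2 * s + 1 - Rabs (2 * s - 1)) / 2)).
  { intros t. unfold Rmin, Rabs. destruct (Rle_dec (2 * t) 1), (Rcase_abs (2 * t - 1)); lra. }
  apply continuity_pt_filterlim. reg. }
assert (Cmax : forall s, continuous (fun s => Rmax (2 * s - 1) 0) s).
{ intros s. apply (continuous_ext (fun s => (2 * s - 1 + Rabs (2 * s - 1)) / 2)).
  { intros t. unfold Rmax, Rabs. destruct (Rle_dec (2 * t - 1) 0), (Rcase_abs (2 * t - 1)); lra. }
  apply continuity_pt_filterlim. reg. }
repeat split.
- intros s. apply contRC_minus; [|apply contRC_const]. apply contRC_plus.
  + apply (continuous_comp (fun s => Rmin (2 * s) 1) p); auto.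
  + apply (continuous_comp (fun s => Rmax (2 * s - 1) 0) q); auto.
- rewrite Rmin_left, Rmax_right by lra. rewrite Rmult_0_r, P0, Q0. ring.
- rewrite Rmin_right, Rmax_left by lra. replace (2 * 1 - 1) with 1 by ring. rewrite P1, Q1. ring.
- intros s Hs. destruct (A s Hs) as [[u [Hu ->]]|[u [Hu ->]]]; auto.
Qed.

(** Radii of the disc are joined to its center in both directions. *)
Lemma bounded_component_near g T z w d : 0 < d ->
  (forall s, 0 <= s <= T -> d <= Cmod (g s - z)) -> Cmod (w - z) < d ->
  (bounded_component g T z <-> bounded_component g T w).
Proof.
intros Hd Hdist Hw.
assert (Hoff : forall t, 0 <= t <= 1 -> ~ on_curve g T (z + t * (w - z))%C).
{ intros t Ht. apply dist_off_curve with (1 := Hd) (2 := Hdist).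
  replace (z + t * (w - z) - z)%C with (t * (w - z))%C by ring.
  rewrite Cmod_mult, Cmod_R, Rabs_pos_eq by lra. pose proof (Cmod_ge_0 (w - z)). nra. }
split; intros [M HM]; exists M; intros v Hv; apply HM; eapply joined_trans; eauto; apply segment_joined; auto.
intros t Ht. replace (w + t * (z - w))%C with (z + RtoC (1 - t) * (w - z))%C.
- apply Hoff. lra.
- rewrite RtoC_minus. ring.
Qed.

Lemma curve_bounded g T : simple_closed_regular g T ->
  exists M, 0 < M /\ forall s, 0 <= s <= T -> Cmod (g s) <= M.
Proof.
intros Hc. apply contRC_bounded; [pose proof (scr_period _ _ Hc); lra|].
intros; eapply contRC_curve; eauto.
Qed.

(** The ray from the origin through [z] leaves every disc without meeting the
    curve. *)
Lemma far_unbounded g T M z : 0 < M -> (forall s, 0 <= s <= T -> Cmod (g s) <= M) ->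
  M < Cmod z -> ~ bounded_component g T z.
Proof.
intros HM Hb Hz [B HB].
set (k := Rabs B / Cmod z + 1).
assert (Hk : 0 <= k).
{ unfold k. assert (0 <= Rabs B / Cmod z); [|lra].
  apply Rdiv_le_0_compat; [apply Rabs_pos | lra]. }
assert (E : forall t, 0 <= t -> Cmod (z + t * (RtoC (1 + k) * z - z))%C = (1 + t * k) * Cmod z).
{ intros t Ht. replace (z + t * (RtoC (1 + k) * z - z))%C with (RtoC (1 + t * k) * z)%C
   by (rewrite !RtoC_plus, RtoC_mult; ring).
  rewrite Cmod_mult, Cmod_R, Rabs_pos_eq; [reflexivity | nra]. }
assert (J : joined_off_curve g T z (RtoC (1 + k) * z)%C).
{ apply segment_joined. intros t Ht [s [Hs F]]. specialize (Hb s Hs). rewrite F, E in Hb by lra.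
  assert (0 <= t * k) by nra. nra. }
apply HB in J. specialize (E 1 ltac:(lra)).
replace (z + 1 * (RtoC (1 + k) * z - z))%C with (RtoC (1 + k) * z)%C in E by ring.
rewrite E in J. unfold k in J.
replace ((1 + 1 * (Rabs B / Cmod z + 1)) * Cmod z) with (Rabs B + 2 * Cmod z) in J by (field; lra).
pose proof (Rle_abs B). lra.
Qed.

(** The derivative in [w] is the integral of [g'/(g-w)^2], which has the
    single-valued primitive [-1/(g-w)]; this is integration by parts with the
    constant function [1]. *)
Lemma winding_locally_constant g T w d : simple_closed_regular g T -> 0 < d ->
  (forall s, 0 <= s <= T -> d <= Cmod (g s - w)) ->
  forall w', Cmod (w' - w) < d ->
  cauchy_integral g T (velocity g) w' = cauchy_integral g T (velocity g) w.
Proof.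
intros Hc Hd Hdist w' Hw'.
assert (D : forall v, Cmod (v - w) < d -> derCC (cauchy_integral g T (velocity g)) v (RtoC 0)).
{ intros v Hv. assert (Hoff := dist_off_curve g T w d Hd Hdist v Hv).
  pose proof (scr_period _ _ Hc) as HT.
  apply cauchy_integral_derive; auto.
  - intros s _. exact (scr_C1 g T Hc s).
  - assert (I := cauchy_by_parts g T (fun _ => RtoC 1) (fun _ => RtoC 0) v Hc Hoff
     (fun s _ => derRC_const _ s) (fun s _ => contRC_const _ s) eq_refl).
    assert (Z : cauchy_integral g T (fun _ => RtoC 0) v = RtoC 0).
    { apply (intRC_unique (fun s => RtoC 0 / (g s - v))%C 0 T).
      - apply cauchy_integral_correct; auto; [lra| |].
        + intros; eapply contRC_curve; eauto.
        + intros; apply contRC_const.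
      - apply (intRC_ext (fun _ => RtoC 0)); [lra| |].
        { intros s _. unfold Cdiv. ring. }
        apply intRC_zero. }
    rewrite Z in I. apply (intRC_ext) with (3 := I); [lra|].
    intros s _. f_equal. ring. }
assert (E := eq_is_derive (V := C_R_NormedModule)
  (fun t => cauchy_integral g T (velocity g) (w + RtoC t * (w' - w))%C) 0 1).
cbv beta in E. replace (w + 1 * (w' - w))%C with w' in E by ring.
replace (w + 0 * (w' - w))%C with w in E by ring.
symmetry. apply E; [|lra]. intros t Ht.
replace (zero : C_R_NormedModule) with (0 * (RtoC 1 * (w' - w)))%C by (rewrite Cmult_0_l; reflexivity).
apply (derRC_comp (cauchy_integral g T (velocity g)) (fun t => w + RtoC t * (w' - w))%C).
- apply D. replace (w + t * (w' - w) - w)%C with (t * (w' - w))%C by ring.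
  rewrite Cmod_mult, Cmod_R, Rabs_pos_eq by lra. pose proof (Cmod_ge_0 (w' - w)). nra.
- apply derRC_pair. simpl. unfold Re, Im; simpl. split; auto_derive; trivial; ring.
Qed.

Lemma winding_constant_on_components g T z w : simple_closed_regular g T -> joined_off_curve g T z w ->
  cauchy_integral g T (velocity g) z = cauchy_integral g T (velocity g) w.
Proof.
intros Hc [p [Cp [P0 [P1 Hp]]]].
rewrite <- P0, <- P1.
apply (eq_is_derive (V := C_R_NormedModule) (fun t => cauchy_integral g T (velocity g) (p t))); [|lra].
intros t Ht. destruct (off_curve_dist g T (p t) Hc (Hp t Ht)) as [d [Hd Hdist]].
apply (is_derive_ext_loc (V := C_R_NormedModule)
  (fun _ => cauchy_integral g T (velocity g) (p t))); [|apply (is_derive_const (V := C_R_NormedModule))].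
destruct (proj1 (contRC_eps p t) (Cp t) d Hd) as [e [He He']].
apply (locally_Rabs t). exists e. split; [exact He|]. intros y Hy. symmetry.
apply winding_locally_constant with d; auto.
Qed.

(** The winding integral is constant on the component, which contains points
    arbitrarily far away, where the integral is arbitrarily small. *)
Lemma winding_exterior g T z : simple_closed_regular g T -> exterior_domain g T z ->
  cauchy_integral g T (velocity g) z = RtoC 0.
Proof.
intros Hc [Hoff Hz]. pose proof (scr_period _ _ Hc) as HT.
assert (Hv : forall s, 0 <= s <= T -> contRC (velocity g) s) by (intros s _; exact (scr_C1 g T Hc s)).
destruct (curve_bounded g T Hc) as [M [HM HMb]].
destruct (contRC_bounded (velocity g) 0 T) as [V [HV HVb]]; auto; [lra|].
apply Cmod_eq_0. apply Rle_antisym; [|apply Cmod_ge_0]. apply le_epsilon. intros eps Heps.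
assert (Hw : exists w, joined_off_curve g T z w /\ M + T * V / eps < Cmod w).
{ apply NNPP. intros H. apply Hz. exists (M + T * V / eps). intros w Hw.
  apply Rnot_lt_le. intros F. apply H. now exists w. }
destruct Hw as [w [Hw Hbig]].
assert (0 < T * V / eps) by (apply Rdiv_lt_0_compat; nra).
rewrite (winding_constant_on_components g T z w Hc Hw).
assert (Hoffw : ~ on_curve g T w) by (intros [s [Hs F]]; specialize (HMb s Hs); rewrite F in HMb; lra).
assert (I := cauchy_integral_correct g T (velocity g) w (Rlt_le _ _ HT)
  (fun s _ => contRC_curve g T Hc s) Hv Hoffw).
replace (0 + eps) with ((T - 0) * (V * / (T * V / eps))) by (field; lra).
apply (intRC_bound_const _ _ _ _ _ (Rlt_le _ _ HT)) with (2 := I).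
intros s Hs. specialize (HMb s Hs). specialize (HVb s Hs).
pose proof (Cmod_triangle_sub w (g s)) as A. rewrite Cmod_minus_comm in A.
assert (N : (g s - w)%C <> 0) by (apply Cmod_pos_neq_0; lra).
rewrite Cmod_div by exact N. apply Rmult_le_compat; try (apply Cmod_ge_0).
- apply Rlt_le, Rinv_0_lt_compat; lra.
- assumption.
- apply Rinv_le_contravar; lra.
Qed.

(** * Cauchy identities for the derivatives, and uniform continuity *)

Lemma contour_RInt_cauchy g T h z :
  contour_RInt g T (fun t => h t / (t - z))%C =
  cauchy_integral g T (fun s => h (g s) * velocity g s)%C z.
Proof.
apply (RInt_ext (V := C_R_CompleteNormedModule)). intros s _.
change ((h (g s) / (g s - z) * velocity g s)%C = (h (g s) * velocity g s / (g s - z))%C).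
unfold Cdiv. ring.
Qed.

Definition cauchy_reproduced g T (h : C -> C) : Prop :=
  (forall z, interior_domain g T z ->
     cauchy_integral g T (fun s => h (g s) * velocity g s)%C z = (RtoC (2 * PI) * Ci * h z)%C) /\
  (forall z, exterior_domain g T z ->
     cauchy_integral g T (fun s => h (g s) * velocity g s)%C z = RtoC 0).

Lemma interior_open g T z : simple_closed_regular g T -> interior_domain g T z ->
  exists d, 0 < d /\ forall w, Cmod (w - z) < d -> interior_domain g T w.
Proof.
intros Hc [Hoff Hb]. destruct (off_curve_dist g T z Hc Hoff) as [d [Hd Hdist]].
exists d. split; [exact Hd|]. intros w Hw. split.
- now apply dist_off_curve with (1 := Hd) (2 := Hdist).
- now apply (bounded_component_near g T z w d).
Qed.

Lemma exterior_open g T z : simple_closed_regular g T -> exterior_domain g T z ->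
  exists d, 0 < d /\ forall w, Cmod (w - z) < d -> exterior_domain g T w.
Proof.
intros Hc [Hoff Hb]. destruct (off_curve_dist g T z Hc Hoff) as [d [Hd Hdist]].
exists d. split; [exact Hd|]. intros w Hw. split.
- now apply dist_off_curve with (1 := Hd) (2 := Hdist).
- now rewrite <- (bounded_component_near g T z w d).
Qed.

Lemma contCC_of_derCC f z l : derCC f z l -> contCC f z.
Proof.
intros H. assert (K := ex_derive_continuous (V := C_NormedModule) f z (ex_intro _ l H)).
intros P HP. apply (locally_C z (fun x => P (f x))). exact (K P HP).
Qed.

Lemma derCC_scal (c : C) f z l : derCC f z l -> derCC (fun w => c * f w)%C z (c * l)%C.
Proof.
intros H.
assert (E := filterdiff_scal_r_fct (K := C_AbsRing) (V := C_NormedModule) c f _ Cmult_comm H).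
eapply filterdiff_ext_lin; [exact E|]. intros y.
change ((c * (y * l))%C = (y * (c * l))%C). ring.
Qed.

(** Both sides of each identity are differentiated in [z], which is legitimate
    because the two domains are open. *)
Lemma reproduced_derive g T (f f' : C -> C) :
  simple_closed_regular g T ->
  (forall z, closed_domain g T z -> derCC f z (f' z)) ->
  (forall z, on_curve g T z -> contCC f' z) ->
  cauchy_reproduced g T f -> cauchy_reproduced g T f'.
Proof.
intros Hc Hf Hf' [Hi He]. pose proof (scr_period _ _ Hc) as HT.
assert (Hon : forall s, 0 <= s <= T -> on_curve g T (g s)) by (intros s Hs; now exists s).
assert (Hfd : forall s, 0 <= s <= T -> derRC (fun s => f (g s)) s (f' (g s) * velocity g s)%C).
{ intros s Hs. apply derRC_comp; [apply Hf; right; auto | now apply (derRC_curve g T)]. }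
assert (Hcd : forall s, 0 <= s <= T -> contRC (fun s => f' (g s) * velocity g s)%C s).
{ intros s Hs. apply contRC_mult; [|exact (scr_C1 g T Hc s)].
  apply (continuous_comp (V := C_UniformSpace) g f'); [now apply (contRC_curve g T) | auto]. }
assert (D : forall z, ~ on_curve g T z ->
  C_derive (cauchy_integral g T (fun s => f (g s) * velocity g s)%C) z =
  cauchy_integral g T (fun s => f' (g s) * velocity g s)%C z).
{ intros z Hz. apply is_C_derive_unique. apply cauchy_integral_derive; auto.
  - intros s Hs. apply contRC_mult; [eapply contRC_of_derRC; eauto | exact (scr_C1 g T Hc s)].
  - apply cauchy_by_parts with (p := fun s => f (g s)); auto.
    now rewrite (curve_endpoints g T Hc). }
split; intros z Hz; rewrite <- D by apply Hz; apply is_C_derive_unique.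
- apply (is_derive_ext_loc (V := C_NormedModule) (fun w => RtoC (2 * PI) * Ci * f w)%C).
  + apply locally_C, locally_Cmod. destruct (interior_open g T z Hc Hz) as [d [Hd H]].
    exists d. split; [exact Hd|]. intros w Hw. symmetry. apply Hi; auto.
  + apply derCC_scal, Hf. now left.
- apply (is_derive_ext_loc (V := C_NormedModule) (fun w => RtoC 0)).
  + apply locally_C, locally_Cmod. destruct (exterior_open g T z Hc Hz) as [d [Hd H]].
    exists d. split; [exact Hd|]. intros w Hw. symmetry. apply He; auto.
  + exact (is_derive_const (V := C_NormedModule) (RtoC 0) z).
Qed.

(** Heine-Cantor.  The gauge given to the compactness of a square isolates a
    point outside [D] from [D], so that only centers in [D] matter. *)
Lemma compact_uniformly_continuous (D : C -> Prop) (h : C -> C) M :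
  (forall z, D z -> Cmod z <= M) ->
  (forall z, ~ D z -> exists d, 0 < d /\ forall w, Cmod (w - z) < d -> ~ D w) ->
  (forall z, D z -> contCC h z) -> uniformly_continuous_on D h.
Proof.
intros HM Hcl Hh eps Heps.
assert (Hd : forall z, exists d, 0 < d /\ forall w, Cmod (w - z) < d -> D w ->
   D z /\ Cmod (h w - h z) < eps / 2).
{ intros z. destruct (classic (D z)) as [Hz|Hz].
  - destruct (proj1 (contCC_eps h z) (Hh z Hz) (eps / 2)) as [d [Hd Hd']]; [lra|].
    exists d. split; auto.
  - destruct (Hcl z Hz) as [d [Hd Hd']]. exists d. split; auto.
    intros w Hw HDw. now elim (Hd' w Hw). }
pose (del := fun z => proj1_sig (constructive_indefinite_description _ (Hd z))).
assert (Hdel : forall z, 0 < del z /\ forall w, Cmod (w - z) < del z -> D w ->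
   D z /\ Cmod (h w - h z) < eps / 2).
{ intros z. exact (proj2_sig (constructive_indefinite_description _ (Hd z))). }
clearbody del.
destruct (compactness_value_2d (- M) M (- M) M
  (* the quarter absorbs the factor [sqrt 2] between [Cmod] and the maximum norm
     and leaves half of [del] for the second point *)
  (fun x y => mkposreal (del (x, y) / 4) ltac:(destruct (Hdel (x, y)); lra))) as [d Hdd].
exists d. split; [apply cond_pos|]. intros z w Hz Hw Hzw.
apply NNPP. intros N.
destruct z as [x y].
assert (Bx : -M <= x <= M /\ -M <= y <= M).
{ pose proof (HM _ Hz). pose proof (Rmax_Cmod (x, y)) as A. simpl in A.
  pose proof (Rmax_l (Rabs x) (Rabs y)). pose proof (Rmax_r (Rabs x) (Rabs y)).
  split; apply Rabs_le_between; lra. }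
apply (Hdd x y); [tauto|tauto|]. intros [u [v [_ [_ [Hu [Hv Hdv]]]]]]. simpl in Hu, Hv, Hdv.
apply N. destruct (Hdel (u, v)) as [Hp Hq].
assert (A : Cmod ((x, y) - (u, v)) < del (u, v) / 2).
{ eapply Rle_lt_trans; [apply Cmod_2Rmax|]. simpl.
  assert (sqrt 2 < 2).
  { rewrite <- (sqrt_Rsqr 2) at 2 by lra. apply sqrt_lt_1; unfold Rsqr; lra. }
  assert (0 <= sqrt 2) by apply sqrt_pos.
  assert (Rmax (Rabs (x + - u)) (Rabs (y + - v)) < del (u, v) / 4) by (apply Rmax_lub_lt; assumption).
  assert (0 <= Rmax (Rabs (x + - u)) (Rabs (y + - v))) by (eapply Rle_trans; [apply Rabs_pos|apply Rmax_l]).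
  nra. }
assert (B : Cmod (w - (u, v)) < del (u, v)).
{ pose proof (Cmod_triangle_minus ((x,y) - (u,v)) ((x,y) - w)) as B.
  replace ((x,y) - (u,v) - ((x,y) - w))%C with (w - (u,v))%C in B by ring. lra. }
destruct (Hq (x, y) ltac:(lra) Hz) as [_ E1]. destruct (Hq w B Hw) as [_ E2].
pose proof (Cmod_triangle_minus (h (x,y) - h (u,v)) (h w - h (u,v))) as F.
replace (h (x,y) - h (u,v) - (h w - h (u,v)))%C with (h (x,y) - h w)%C in F by ring. lra.
Qed.

(** * The kernels of the tangent line *)

Definition poisson (rho u : R) : R := rho / (u * u + rho * rho).

(** The Poisson kernel and its conjugate, continued to complex arguments. *)
Definition cpoisson (rho : R) (Y : C) : C := (RtoC rho / (Y * Y + RtoC (rho * rho)))%C.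
Definition conj_poisson (rho : R) (Y : C) : C := (Y / (Y * Y + RtoC (rho * rho)))%C.

Lemma Cmod_near_real (Y : C) (u e : R) : 0 <= u -> 0 <= e <= 1/8 ->
  Cmod (Y - u) <= e * u -> Cmod Y <= 2 * u /\ u / 2 <= Cmod Y /\
  Cmod (Y + u) <= 3 * u.
Proof.
intros Hu He H.
assert (Eu : Cmod u = u) by (rewrite Cmod_R; apply Rabs_pos_eq; lra).
pose proof (Cmod_triangle (Y - u) u) as A. replace (Y - u + u)%C with Y in A by ring.
pose proof (Cmod_triangle_minus Y (Y - u)) as B. replace (Y - (Y - u))%C with (RtoC u) in B by ring.
pose proof (Cmod_triangle Y u) as D.
rewrite Eu in *. repeat split; nra.
Qed.

(** Near the real axis in the sense of relative error, [Y^2] stays away from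
    [-rho^2]. *)
Lemma denominator_near_real (Y : C) (u e rho : R) : 0 <= u -> 0 <= e <= 1/8 ->
  Cmod (Y - u) <= e * u -> (u * u + rho * rho) / 2 <= Cmod (Y * Y + RtoC (rho * rho)).
Proof.
intros Hu He H. destruct (Cmod_near_real Y u e Hu He H) as [_ [_ H3]].
assert (Eq : Cmod (RtoC (u * u + rho * rho)) = u * u + rho * rho) by (rewrite Cmod_R; apply Rabs_pos_eq; nra).
pose proof (Cmod_triangle_minus (Y * Y + RtoC (rho * rho)) ((Y - u) * (Y + u))) as A.
replace (Y * Y + RtoC (rho * rho) - (Y - u) * (Y + u))%C with (RtoC (u * u + rho * rho)) in A
 by (rewrite !RtoC_plus, !RtoC_mult; ring).
rewrite Eq, Cmod_mult in A.
assert (Cmod (Y - u) * Cmod (Y + u) <= (e * u) * (3 * u)).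
{ apply Rmult_le_compat; try apply Cmod_ge_0; assumption. }
nra.
Qed.

Lemma Cmod_div_le (N D : C) (n d : R) : 0 < d -> Cmod N <= n -> d <= Cmod D ->
  Cmod (N / D) <= n / d.
Proof.
intros Hd HN HD. rewrite Cmod_div by (apply Cmod_pos_neq_0; lra).
apply Rmult_le_compat; auto; try apply Cmod_ge_0.
- apply Rlt_le, Rinv_0_lt_compat; lra.
- apply Rinv_le_contravar; assumption.
Qed.

Lemma Rdiv_le_cross a b c d : 0 < b -> 0 < d -> a * d <= c * b -> a / b <= c / d.
Proof.
intros Hb Hd H. apply (Rmult_le_reg_r (b * d)); [nra|].
replace (a / b * (b * d)) with (a * d) by (field; lra).
replace (c / d * (b * d)) with (c * b) by (field; lra). exact H.
Qed.

Lemma RtoC_neq_0 (x : R) : x <> 0 -> RtoC x <> 0.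
Proof. intros H E. apply H. now apply RtoC_inj. Qed.

(** Errors are measured against the Poisson kernel because its integral is
    bounded independently of [rho].  The constants are not sharp: they serve the
    three kernels below at once. *)
Definition kernel_close (E : C) (E0 : R) (e rho u : R) : Prop :=
  Cmod E <= 8 * poisson rho u /\ Cmod (E - RtoC E0) <= 56 * e * poisson rho u.

Lemma poisson_close Y u e rho : 0 <= u -> 0 <= e <= 1/8 -> 0 < rho ->
  Cmod (Y - u) <= e * u ->
  kernel_close (cpoisson rho Y) (poisson rho u) e rho u.
Proof.
intros Hu He Hr H. unfold kernel_close, cpoisson, poisson.
destruct (Cmod_near_real Y u e Hu He H) as [H1 [H2 H3]].
pose proof (denominator_near_real Y u e rho Hu He H) as HD.
set (q := u * u + rho * rho) in *. assert (Hq : 0 < q) by (unfold q; nra).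
assert (N : (Y * Y + RtoC (rho * rho))%C <> 0) by (apply Cmod_pos_neq_0; lra).
assert (Er : Cmod rho = rho) by (rewrite Cmod_R; apply Rabs_pos_eq; lra).
split.
- eapply Rle_trans. { apply (Cmod_div_le _ _ rho (q / 2)); [lra | lra | exact HD]. }
  apply Rle_trans with (2 * (rho / q)); [right; field; lra|].
  assert (0 < rho / q) by (apply Rdiv_lt_0_compat; lra). lra.
- replace (rho / (Y * Y + (rho * rho)%R) - (rho / q)%R)%C with
   (- (RtoC rho * ((Y - u) * (Y + u))) / ((Y * Y + RtoC (rho * rho)) * RtoC q))%C.
  2: { rewrite RtoC_div by lra. unfold q. pose proof (RtoC_neq_0 q ltac:(lra)) as Nq. unfold q in Nq.
       rewrite RtoC_plus, RtoC_mult in Nq |- *. rewrite RtoC_mult in *. field. split; assumption. }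
  eapply Rle_trans. { apply (Cmod_div_le _ _ (rho * ((e * u) * (3 * u))) ((q / 2) * q)).
   - nra.
   - rewrite Cmod_opp, !Cmod_mult, Er. apply Rmult_le_compat_l; [lra|].
     apply Rmult_le_compat; try apply Cmod_ge_0; assumption.
   - rewrite Cmod_mult, (Cmod_R q), (Rabs_pos_eq q) by lra. apply Rmult_le_compat_r; lra. }
  replace (56 * e * (rho / q)) with ((56 * e * rho) / q) by (field; lra).
  apply Rdiv_le_cross; [nra|lra|].
  assert (u * u <= q) by (unfold q; nra).
  assert (0 <= rho * e * q) by (apply Rmult_le_pos; nra).
  replace (rho * (e * u * (3 * u)) * q) with (3 * (rho * e * q) * (u * u)) by ring.
  replace (56 * e * rho * (q / 2 * q)) with (28 * (rho * e * q) * q) by field. nra.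
Qed.

(** [Y/(Y^2+rho^2)] alone decays like [1/Y], and an error [e/u] would integrate to
    a logarithm of [rho]; the comparison is therefore limited to [u <= 2 rho],
    where [u/(u^2+rho^2)] is at most twice the Poisson kernel. *)
Lemma conj_poisson_close_inner Y u e rho : 0 <= u <= 2 * rho -> 0 <= e <= 1/8 -> 0 < rho ->
  Cmod (Y - u) <= e * u ->
  kernel_close (conj_poisson rho Y) (u / (u * u + rho * rho)) e rho u.
Proof.
intros [Hu Hu2] He Hr H. unfold kernel_close, conj_poisson, poisson.
destruct (Cmod_near_real Y u e Hu He H) as [H1 [H2 H3]].
pose proof (denominator_near_real Y u e rho Hu He H) as HD.
set (q := u * u + rho * rho) in *. assert (Hq : 0 < q) by (unfold q; nra).
assert (N : (Y * Y + RtoC (rho * rho))%C <> 0) by (apply Cmod_pos_neq_0; lra).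
split.
- eapply Rle_trans. { apply (Cmod_div_le _ _ (2 * u) (q / 2)); [lra | lra | exact HD]. }
  replace (8 * (rho / q)) with ((8 * rho) / q) by (field; lra).
  apply Rdiv_le_cross; nra.
- replace (Y / (Y * Y + (rho * rho)%R) - (u / q)%R)%C with
   ((Y - u) * (RtoC (rho * rho) - RtoC u * Y) / ((Y * Y + RtoC (rho * rho)) * RtoC q))%C.
  2: { rewrite RtoC_div by lra. unfold q. pose proof (RtoC_neq_0 q ltac:(lra)) as Nq. unfold q in Nq.
       rewrite RtoC_plus, RtoC_mult in Nq |- *. rewrite RtoC_mult in *. field. split; assumption. }
  eapply Rle_trans. { apply (Cmod_div_le _ _ ((e * u) * (rho * rho + u * (2 * u))) ((q / 2) * q)).
   - nra.
   - rewrite Cmod_mult. apply Rmult_le_compat; try apply Cmod_ge_0; [assumption|].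
     eapply Rle_trans; [apply Cmod_triangle_minus|].
     rewrite Cmod_mult, !Cmod_R, !Rabs_pos_eq by nra. nra.
   - rewrite Cmod_mult, (Cmod_R q), (Rabs_pos_eq q) by lra. apply Rmult_le_compat_r; lra. }
  replace (56 * e * (rho / q)) with ((56 * e * rho) / q) by (field; lra).
  apply Rdiv_le_cross; [nra|lra|].
  assert (rho * rho + u * (2 * u) <= 2 * q) by (unfold q; nra).
  assert (0 <= e * q) by nra.
  replace (e * u * (rho * rho + u * (2 * u)) * q) with ((e * q) * (u * (rho * rho + u * (2 * u)))) by ring.
  replace (56 * e * rho * (q / 2 * q)) with ((e * q) * (28 * rho * q)) by field.
  apply Rmult_le_compat_l; [lra|].
  apply Rle_trans with ((2 * rho) * (2 * q)); [|nra].
  apply Rmult_le_compat; nra.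
Qed.

(** Beyond the truncation radius, subtracting [1/Y] leaves
    [-rho^2/(Y (Y^2+rho^2))], which decays fast enough to be compared with the
    Poisson kernel. *)
Lemma conj_poisson_close_outer Y u e rho : rho / 2 <= u -> 0 <= e <= 1/8 -> 0 < rho ->
  Cmod (Y - u) <= e * u ->
  kernel_close (conj_poisson rho Y - / Y)%C (u / (u * u + rho * rho) - / u) e rho u.
Proof.
intros Hu2 He Hr H. unfold kernel_close, conj_poisson, poisson.
assert (Hu : 0 < u) by lra.
destruct (Cmod_near_real Y u e (Rlt_le _ _ Hu) He H) as [H1 [H2 H3]].
pose proof (denominator_near_real Y u e rho (Rlt_le _ _ Hu) He H) as HD.
set (q := u * u + rho * rho) in *. assert (Hq : 0 < q) by (unfold q; nra).
assert (N : (Y * Y + RtoC (rho * rho))%C <> 0) by (apply Cmod_pos_neq_0; lra).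
assert (NY : Y <> 0) by (apply Cmod_pos_neq_0; lra).
assert (Eu : Cmod u = u) by (rewrite Cmod_R; apply Rabs_pos_eq; lra).
assert (Err : Cmod (RtoC (rho * rho)) = rho * rho) by (rewrite Cmod_R; apply Rabs_pos_eq; nra).
split.
- replace (Y / (Y * Y + (rho * rho)%R) - / Y)%C with
   (- RtoC (rho * rho) / (Y * (Y * Y + RtoC (rho * rho))))%C by (field; split; assumption).
  eapply Rle_trans. { apply (Cmod_div_le _ _ (rho * rho) ((u / 2) * (q / 2))).
   - nra.
   - rewrite Cmod_opp, Err; lra.
   - rewrite Cmod_mult. apply Rmult_le_compat; lra. }
  replace (8 * (rho / q)) with ((8 * rho) / q) by (field; lra).
  apply Rdiv_le_cross; [nra|lra|].
  replace (rho * rho * q) with (rho * q * rho) by ring.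
  replace (8 * rho * (u / 2 * (q / 2))) with (rho * q * (2 * u)) by field.
  apply Rmult_le_compat_l; [nra | lra].
- replace (Y / (Y * Y + (rho * rho)%R) - / Y - (u / q - / u)%R)%C with
   (RtoC (rho * rho) * ((Y - u) * (Y * Y + u * Y + RtoC q)) /
     (RtoC u * Y * ((Y * Y + RtoC (rho * rho)) * RtoC q)))%C.
  2: { rewrite RtoC_minus, RtoC_div, RtoC_inv by lra. unfold q.
       pose proof (RtoC_neq_0 q ltac:(lra)) as Nq. unfold q in Nq.
       pose proof (RtoC_neq_0 u ltac:(lra)) as Nu.
       rewrite RtoC_plus, RtoC_mult in Nq |- *. rewrite RtoC_mult in *. field. repeat split; assumption. }
  eapply Rle_trans. { apply (Cmod_div_le _ _ (rho * rho * ((e * u) * (7 * q))) (u * (u / 2) * ((q / 2) * q))).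
   - apply Rmult_lt_0_compat; nra.
   - rewrite !Cmod_mult, Err. apply Rmult_le_compat_l; [nra|].
     apply Rmult_le_compat; try apply Cmod_ge_0; [assumption|].
     eapply Rle_trans; [apply Cmod_triangle|].
     pose proof (Cmod_triangle (Y * Y) (u * Y)) as A. rewrite !Cmod_mult, Eu in A.
     rewrite (Cmod_R q), (Rabs_pos_eq q) by lra. pose proof (Cmod_ge_0 Y).
     assert (Cmod Y * Cmod Y <= 4 * (u * u)) by nra.
     assert (u * Cmod Y <= 2 * (u * u)) by nra.
     assert (u * u <= q) by (unfold q; nra). lra.
   - rewrite !Cmod_mult, Eu, (Cmod_R q), (Rabs_pos_eq q) by lra.
     apply Rmult_le_compat; [nra|nra| |]; [apply Rmult_le_compat_l | apply Rmult_le_compat_r]; lra. }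
  replace (56 * e * (rho / q)) with ((56 * e * rho) / q) by (field; lra).
  apply Rdiv_le_cross; [apply Rmult_lt_0_compat; nra|lra|].
  replace (rho * rho * (e * u * (7 * q)) * q) with ((e * rho * u * (q * q)) * (7 * rho)) by ring.
  replace (56 * e * rho * (u * (u / 2) * (q / 2 * q))) with ((e * rho * u * (q * q)) * (14 * u)) by field.
  apply Rmult_le_compat_l; [|lra].
  repeat apply Rmult_le_pos; lra.
Qed.

Lemma is_RInt_poisson rho a b : 0 < rho ->
  is_RInt (poisson rho) a b (atan (b / rho) - atan (a / rho)).
Proof.
intros Hr. apply (is_RInt_derive (V := R_CompleteNormedModule) (fun u => atan (u / rho))); intros u _.
- unfold poisson. auto_derive; [exact I|]. unfold Rsqr. field. repeat split; nra.
- unfold poisson. apply continuity_pt_filterlim. reg. nra.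
Qed.

(** Freezing the density at [0] and replacing the kernel by the real one costs
    [O(e)] times the mass of the Poisson kernel, which is at most [pi/2 <= 2]. *)
Lemma kernel_integral_near (phi E : R -> C) (E0 : R -> R) (e rho x y : R) (I : C) (J : R) :
  0 <= x <= y -> 0 < rho -> 0 <= e ->
  (forall u, x <= u <= y -> Cmod (phi u - phi 0) <= e) ->
  (forall u, x <= u <= y -> kernel_close (E u) (E0 u) e rho u) ->
  intRC (fun u => phi u * E u)%C x y I -> is_RInt E0 x y J ->
  Cmod (I - phi 0 * RtoC J) <= e * (8 + 56 * Cmod (phi 0)) * 2.
Proof.
intros Hxy Hr He Hphi HE HI HJ.
assert (HJ' : intRC (fun u => phi 0 * RtoC (E0 u))%C x y (phi 0 * RtoC J)%C).
{ apply intRC_scal. apply intRC_pair. split; [exact HJ|].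
  replace (Im J) with (minus 0 0) by (unfold minus, plus, opp; simpl; ring).
  exact (is_RInt_derive (V := R_CompleteNormedModule) (fun _ => 0) (fun _ => 0) x y
     (fun s _ => is_derive_const _ s) (fun s _ => continuous_const _ s)). }
assert (P := is_RInt_scal (V := R_NormedModule) _ _ _ (e * (8 + 56 * Cmod (phi 0))) _ (is_RInt_poisson rho x y Hr)).
eapply Rle_trans; [refine (intRC_bound _ _ _ _ _ _ (proj2 Hxy) _ (intRC_minus _ _ _ _ _ _ HI HJ') P)|].
- intros u Hu. destruct (HE u Hu) as [H1 H2]. specialize (Hphi u Hu).
  replace (phi u * E u - phi 0 * E0 u)%C with ((phi u - phi 0) * E u + phi 0 * (E u - E0 u))%C by ring.
  eapply Rle_trans; [apply Cmod_triangle|]. rewrite !Cmod_mult.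
  change (scal (e * (8 + 56 * Cmod (phi 0))) (poisson rho u)) with
    (e * (8 + 56 * Cmod (phi 0)) * poisson rho u).
  assert (A1 : Cmod (phi u - phi 0) * Cmod (E u) <= e * (8 * poisson rho u))
    by (apply Rmult_le_compat; try apply Cmod_ge_0; assumption).
  assert (A2 : Cmod (phi 0) * Cmod (E u - E0 u) <= Cmod (phi 0) * (56 * e * poisson rho u))
    by (apply Rmult_le_compat_l; [apply Cmod_ge_0 | assumption]).
  lra.
- change (e * (8 + 56 * Cmod (phi 0)) * (atan (y / rho) - atan (x / rho)) <=
    e * (8 + 56 * Cmod (phi 0)) * 2).
  apply Rmult_le_compat_l.
  + pose proof (Cmod_ge_0 (phi 0)). nra.
  + pose proof (proj2 (atan_bound (y / rho))). pose proof PI_4.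
    assert (0 <= atan (x / rho)); [|lra].
    rewrite <- atan_0. destruct (Req_dec x 0) as [->|Hx].
    * unfold Rdiv. rewrite Rmult_0_l. lra.
    * apply Rlt_le, atan_increasing. apply Rdiv_lt_0_compat; lra.
Qed.

Lemma atan_le x : 0 < x -> atan x <= x.
Proof.
intros Hx. destruct (MVT_cor2 atan (fun x => / (1 + x ^ 2)) 0 x Hx) as [c [E Hc]].
{ intros c _. apply derivable_pt_lim_atan. }
rewrite atan_0, !Rminus_0_r in E. rewrite E.
rewrite <- (Rmult_1_l x) at 2. apply Rmult_le_compat_r; [lra|].
rewrite <- Rinv_1. apply Rinv_le_contravar; nra.
Qed.

Lemma atan_large x : 0 < x -> PI / 2 - / x <= atan x < PI / 2.
Proof.
intros Hx. split; [|apply atan_bound].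
pose proof (atan_le (/ x) (Rinv_0_lt_compat _ Hx)). rewrite atan_inv in H by assumption. lra.
Qed.

Lemma ln_le_minus_1 x : 0 < x -> ln x <= x - 1.
Proof.
intros Hx. destruct (Req_dec (ln x) 0) as [E|N].
- rewrite E. apply Req_le. assert (x = exp 0) by (rewrite <- E, exp_ln; auto). rewrite H, exp_0. ring.
- pose proof (exp_ineq1 _ N). rewrite exp_ln in H by assumption. lra.
Qed.

Lemma is_RInt_conj_inner rho b : 0 < rho ->
  is_RInt (fun u => u / (u * u + rho * rho)) 0 b
   (/ 2 * ln (b * b + rho * rho) - ln rho).
Proof.
intros Hr.
replace (ln rho) with (/ 2 * ln (0 * 0 + rho * rho)).
2: { rewrite Rmult_0_l, Rplus_0_l, ln_mult by assumption. field. }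
apply (is_RInt_derive (V := R_CompleteNormedModule) (fun u => / 2 * ln (u * u + rho * rho))); intros u _.
- auto_derive; [nra|]. field. nra.
- apply continuity_pt_filterlim. reg. nra.
Qed.

Lemma is_RInt_conj_outer rho a b : 0 < rho -> 0 < a <= b ->
  is_RInt (fun u => u / (u * u + rho * rho) - / u) a b
   ((/ 2 * ln (b * b + rho * rho) - ln b) - (/ 2 * ln (a * a + rho * rho) - ln a)).
Proof.
intros Hr Hab.
apply (is_RInt_derive (V := R_CompleteNormedModule) (fun u => / 2 * ln (u * u + rho * rho) - ln u));
 rewrite Rmin_left, Rmax_right by lra; intros u Hu.
- auto_derive; [split; [nra|split; [lra|exact I]]|]. field. split; nra.
- apply continuity_pt_filterlim. reg; nra.
Qed.

(** On the line the conjugate kernel on [0, r] minus [1/u] on [beta, r] has mass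
    [ln (1 + rho^2/r^2) / 2 + ln (beta/rho)]: each half-line converges by itself,
    so that the two sides of a point need not be paired. *)
Lemma truncated_conj_mass_small rho beta r e : 0 < rho -> 0 < beta <= r -> 0 <= e <= 1/8 ->
  (1 - e) * beta <= rho <= (1 + e) * beta -> rho * rho <= e * (r * r) ->
  Rabs ((/ 2 * ln (beta * beta + rho * rho) - ln rho) +
   ((/ 2 * ln (r * r + rho * rho) - ln r) - (/ 2 * ln (beta * beta + rho * rho) - ln beta))) <= 3 * e.
Proof.
intros Hr Hb He [H1 H2] H3.
assert (0 < beta / rho) by (apply Rdiv_lt_0_compat; lra).
assert (0 < rho / beta) by (apply Rdiv_lt_0_compat; lra).
assert (E1 : ln (r * r + rho * rho) = 2 * ln r + ln (1 + rho * rho / (r * r))).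
{ replace (r * r + rho * rho) with (r * r * (1 + rho * rho / (r * r))) by (field; lra).
  assert (0 <= rho * rho / (r * r)) by (apply Rdiv_le_0_compat; nra).
  rewrite !ln_mult; try nra. }
assert (Hx : 0 <= rho * rho / (r * r) <= e).
{ split; [apply Rdiv_le_0_compat; nra|]. apply (Rmult_le_reg_r (r * r)); [nra|].
  replace (rho * rho / (r * r) * (r * r)) with (rho * rho) by (field; lra). exact H3. }
set (x := rho * rho / (r * r)) in *.
assert (L1 : ln (1 + x) <= x) by (pose proof (ln_le_minus_1 (1 + x)); lra).
assert (L0 : 0 <= ln (1 + x)).
{ rewrite <- ln_1. destruct (Req_dec x 0) as [->|]; [rewrite Rplus_0_r; lra|]. apply Rlt_le, ln_increasing; lra. }
assert (L2 : ln beta - ln rho <= 2 * e).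
{ rewrite <- ln_div by lra. eapply Rle_trans; [apply ln_le_minus_1; assumption|].
  assert (beta / rho <= 1 + 2 * e); [|lra].
  apply (Rmult_le_reg_r rho); [lra|]. replace (beta / rho * rho) with beta by (field; lra). nra. }
assert (L3 : ln rho - ln beta <= e).
{ rewrite <- ln_div by lra. eapply Rle_trans; [apply ln_le_minus_1; assumption|].
  assert (rho / beta <= 1 + e); [|lra].
  apply (Rmult_le_reg_r beta); [lra|]. replace (rho / beta * beta) with rho by (field; lra). nra. }
rewrite E1. apply Rabs_le. split; lra.
Qed.

(** * Limits at a point of the curve *)

Lemma intRC_split (f : R -> C) a b c (I : C) : a <= b <= c -> intRC f a c I ->
  exists I1 I2, intRC f a b I1 /\ intRC f b c I2 /\ I = (I1 + I2)%C.
Proof.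
intros H HI.
assert (E : ex_RInt (V := C_R_CompleteNormedModule) f a c) by now exists I.
destruct (ex_RInt_Chasles_1 (V := C_R_CompleteNormedModule) f a b c H E) as [I1 H1].
destruct (ex_RInt_Chasles_2 (V := C_R_CompleteNormedModule) f a b c H E) as [I2 H2].
exists I1, I2. repeat split; auto.
apply (intRC_unique f a c); [exact HI|].
exact (is_RInt_Chasles (V := C_R_NormedModule) f a b c I1 I2 H1 H2).
Qed.

Lemma intRC_Chasles (f : R -> C) a b c (I1 I2 : C) :
  intRC f a b I1 -> intRC f b c I2 -> intRC f a c (I1 + I2)%C.
Proof. exact (is_RInt_Chasles (V := C_R_NormedModule) f a b c I1 I2). Qed.

Lemma denominator_away_from_0 (Y : C) m rho : 0 < m <= Cmod Y -> 0 < rho <= m / 2 ->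
  m ^ 2 / 2 <= Cmod (Y * Y + RtoC (rho * rho)).
Proof.
intros Hm Hr. pose proof (Cmod_triangle_minus (Y * Y + RtoC (rho * rho)) (RtoC (rho * rho))) as A.
replace (Y * Y + RtoC (rho * rho) - RtoC (rho * rho))%C with (Y * Y)%C in A by ring.
rewrite Cmod_mult, (Cmod_R (rho * rho)), Rabs_pos_eq in A by nra. nra.
Qed.

(** The increment [D] makes an acute angle with [Y], both being nearly positive
    reals. *)
Lemma modulus_increasing (Y D : C) u h : 0 <= u -> 0 < h ->
  Cmod (Y - u) <= / 8 * u -> Cmod (D - h) <= / 8 * h -> Cmod Y < Cmod (Y + D).
Proof.
intros Hu Hh HY HD.
apply Rsqr_incrst_0; try apply Cmod_ge_0. rewrite !Rsqr_pow2, !Cmod2_alt.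
pose proof (Rle_trans _ _ _ (re_le_Cmod _) HY) as A1.
pose proof (Rle_trans _ _ _ (im_le_Cmod _) HY) as A2.
pose proof (Rle_trans _ _ _ (re_le_Cmod _) HD) as A3.
pose proof (Rle_trans _ _ _ (im_le_Cmod _) HD) as A4.
destruct Y as [p q], D as [s t]. unfold Re, Im in *; simpl in *.
apply Rabs_le_between in A1, A2, A3, A4.
assert (7/8 * u <= p) by lra. assert (7/8 * h <= s) by lra.
assert (p * s >= 49/64 * (u * h)) by nra.
assert (q * t >= - (1/64) * (u * h)).
{ assert (Hqt : Rabs (q * t) <= (u/8) * (h/8)).
  { rewrite Rabs_mult. apply Rmult_le_compat; try apply Rabs_pos; apply Rabs_le; lra. }
  apply Rabs_le_between in Hqt. lra. }
assert (0 <= u * h) by nra. nra.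
Qed.

(** Here [Y] is a curve through [0] with strict derivative [1] there.  Since [|Y|]
    increases near [0] and is bounded below elsewhere, for small [rho] the
    truncation [|Y| >= rho] cuts off exactly an interval [[0, beta)] with
    [|Y beta| = rho], which also gives the integrability of the truncated
    function.  The integrals are then split at [beta] and at a fixed [r]: up to
    [r] the kernels are compared with those of the line, beyond [r] they tend to
    [0] uniformly. *)
Lemma one_sided_limits (Y phi : R -> C) (b : R) : 0 < b ->
  (forall u, contRC Y u) -> (forall u, contRC phi u) -> Y 0 = RtoC 0 ->
  (forall e, 0 < e -> exists r, 0 < r /\ forall u v, 0 <= u <= v -> v <= r ->
     Cmod (Y v - Y u - RtoC (v - u)) <= e * (v - u)) ->
  (forall u, 0 < u <= b -> Y u <> RtoC 0) ->
  forall eps, 0 < eps -> exists rho0, 0 < rho0 /\ forall rho, 0 < rho < rho0 ->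
  (forall u, 0 <= u <= b -> (Y u * Y u + RtoC (rho * rho))%C <> 0) /\
  (forall I, intRC (fun u => phi u * cpoisson rho (Y u))%C 0 b I ->
     Cmod (I - phi 0 * RtoC (PI / 2)) <= eps) /\
  exists J, intRC (fun u => if Rle_dec rho (Cmod (Y u)) then (phi u * / Y u)%C else RtoC 0) 0 b J /\
  forall I, intRC (fun u => phi u * conj_poisson rho (Y u))%C 0 b I ->
     Cmod (I - J) <= eps.
Proof.
intros Hb CY Cphi Y0 HS Hne eps Heps.
set (p0 := Cmod (phi 0)). assert (Hp0 : 0 <= p0) by apply Cmod_ge_0.
set (k := 8 + 56 * p0).
(* [k] is the constant of [kernel_integral_near] for the density [phi] *)
set (e := Rmin (1/8) (eps / (10 * k))).
assert (He : 0 < e <= 1/8).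
{ unfold e. split; [|apply Rmin_l]. apply Rmin_pos; [lra|]. apply Rdiv_lt_0_compat; unfold k; lra. }
assert (Hek : e * k <= eps / 10).
{ replace (eps / 10) with (eps / (10 * k) * k) by (unfold k; field; lra).
  apply Rmult_le_compat_r; [unfold k; lra | apply Rmin_r]. }
destruct (HS e (proj1 He)) as [r1 [Hr1 HS1]].
destruct (proj1 (contRC_eps phi 0) (Cphi 0) e (proj1 He)) as [r2 [Hr2 Hphi2]].
set (r := Rmin b (Rmin r1 (r2 / 2))).
assert (Hr : 0 < r /\ r <= b /\ r <= r1 /\ r < r2).
{ unfold r. pose proof (Rmin_l b (Rmin r1 (r2/2))). pose proof (Rmin_r b (Rmin r1 (r2/2))).
  pose proof (Rmin_l r1 (r2/2)). pose proof (Rmin_r r1 (r2/2)).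
  split; [repeat apply Rmin_pos; lra | lra]. }
destruct Hr as [Hr [Hrb [Hrr1 Hrr2]]]. clearbody r.
assert (Hnear : forall u, 0 <= u <= r -> Cmod (Y u - u) <= e * u).
{ intros u Hu. pose proof (HS1 0 u ltac:(lra) ltac:(lra)) as A. rewrite Y0, Rminus_0_r in A.
  replace (Y u - 0 - u)%C with (Y u - u)%C in A by ring. exact A. }
assert (Hphi : forall u, 0 <= u <= r -> Cmod (phi u - phi 0) <= e).
{ intros u Hu. apply Rlt_le, Hphi2. rewrite Rminus_0_r, Rabs_pos_eq; lra. }
assert (Hmono : forall u v, 0 <= u < v -> v <= r -> Cmod (Y u) < Cmod (Y v)).
{ intros u v Huv Hv. replace (Y v) with (Y u + (Y v - Y u))%C by ring.
  apply modulus_increasing with u (v - u); try lra.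
  - eapply Rle_trans; [apply Hnear; lra|]. apply Rmult_le_compat_r; lra.
  - eapply Rle_trans; [apply HS1; lra|]. apply Rmult_le_compat_r; lra. }
destruct (continuous_pos_bounded_below (fun u => Cmod (Y u)) r b Hrb) as [m [Hm Hmb]].
{ intros; now apply contRC_Cmod. }
{ intros u Hu. apply Cmod_gt_0, Hne; lra. }
destruct (contRC_bounded phi 0 b (Rlt_le _ _ Hb) (fun u _ => Cphi u)) as [M [HM HMb]].
(* the four bounds: non-vanishing and truncation far from [0], mass of the
   conjugate kernel, mass of the Poisson kernel beyond [r], and the kernels
   themselves beyond [r] *)
set (rho0 := Rmin (Rmin (m / 2) (e * r)) (Rmin (eps * r / (4 * (p0 + 1))) (eps * m ^ 2 / (8 * b * M)))).
exists rho0. split.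
{ unfold rho0. repeat apply Rmin_pos; try nra; apply Rdiv_lt_0_compat; try nra.
  apply Rmult_lt_0_compat; nra. }
intros rho [Hrho Hlt].
assert (Hc1 : rho <= m / 2 /\ rho <= e * r /\ rho <= eps * r / (4 * (p0 + 1)) /\ rho <= eps * m ^ 2 / (8 * b * M)).
{ unfold rho0 in Hlt. repeat (apply Rmin_Rgt in Hlt; destruct Hlt as [? Hlt]).
  repeat match goal with H : Rmin _ _ > _ |- _ => apply Rmin_Rgt in H; destruct H end. lra. }
clear Hlt. destruct Hc1 as [Hc1 [Hc2 [Hc3 Hc4]]]. clearbody e.
assert (Hfar : b * (M * (rho * / (m ^ 2 / 2))) <= eps / 4).
{ apply Rle_trans with (b * (M * (eps * m ^ 2 / (8 * b * M) * / (m ^ 2 / 2)))).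
  - apply Rmult_le_compat_l; [lra|]. apply Rmult_le_compat_l; [lra|].
    apply Rmult_le_compat_r; [|lra]. apply Rlt_le, Rinv_0_lt_compat; nra.
  - right. field. repeat split; lra. }
assert (Hden : forall u, 0 <= u <= b -> (Y u * Y u + RtoC (rho * rho))%C <> 0).
{ intros u Hu. apply Cmod_pos_neq_0. destruct (Rle_dec u r).
  - pose proof (denominator_near_real (Y u) u e rho ltac:(lra) ltac:(lra) (Hnear u ltac:(lra))). nra.
  - pose proof (denominator_away_from_0 (Y u) m rho (conj Hm (Hmb u ltac:(lra))) (conj Hrho Hc1)). nra. }
split; [exact Hden|]. split.
- intros I HI. destruct (intRC_split _ 0 r b I ltac:(lra) HI) as [I1 [I2 [H1 [H2 ->]]]].
  assert (N1 := kernel_integral_near phi (fun u => cpoisson rho (Y u)) (poisson rho) e rho 0 r I1 _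
    ltac:(lra) Hrho ltac:(lra) Hphi
    (fun u Hu => poisson_close (Y u) u e rho (proj1 Hu) ltac:(lra) Hrho (Hnear u Hu)) H1
    (is_RInt_poisson rho 0 r Hrho)).
  assert (N2 : Cmod I2 <= eps / 4).
  { apply Rle_trans with ((b - r) * (M * (rho * / (m ^ 2 / 2)))).
    - apply (intRC_bound_const _ _ _ _ _ Hrb) with (2 := H2). intros u Hu.
      rewrite Cmod_mult. apply Rmult_le_compat; try apply Cmod_ge_0; [apply HMb; lra|].
      apply Cmod_div_le; [nra| |].
      + rewrite Cmod_R, Rabs_pos_eq; lra.
      + apply denominator_away_from_0; auto.
    - eapply Rle_trans; [|exact Hfar]. apply Rmult_le_compat_r; [|lra].
      apply Rmult_le_pos; [lra|]. apply Rmult_le_pos; [lra|]. apply Rlt_le, Rinv_0_lt_compat; nra. }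
  fold p0 in N1. fold k in N1.
  replace (0 / rho) with 0 in N1 by (field; lra). rewrite atan_0, Rminus_0_r in N1.
  assert (N3 : Cmod (phi 0 * RtoC (PI / 2 - atan (r / rho))) <= eps / 4).
  { rewrite Cmod_mult, Cmod_R. fold p0.
    assert (Hrr : 0 < r / rho) by (apply Rdiv_lt_0_compat; lra).
    pose proof (atan_large (r / rho) Hrr) as A. rewrite Rabs_pos_eq by lra.
    assert (PI / 2 - atan (r / rho) <= eps / (4 * (p0 + 1))).
    { apply Rle_trans with (/ (r / rho)); [lra|]. replace (/ (r / rho)) with (rho / r) by (field; lra).
      apply (Rmult_le_reg_r r); [lra|]. replace (rho / r * r) with rho by (field; lra).
      replace (eps / (4 * (p0 + 1)) * r) with (eps * r / (4 * (p0 + 1))) by (field; lra). exact Hc3. }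
    apply Rle_trans with (p0 * (eps / (4 * (p0 + 1)))).
    - apply Rmult_le_compat_l; lra.
    - replace (eps / 4) with ((p0 + 1) * (eps / (4 * (p0 + 1)))) by (field; lra).
      apply Rmult_le_compat_r; [|lra]. apply Rlt_le, Rdiv_lt_0_compat; lra. }
  replace (I1 + I2 - phi 0 * RtoC (PI / 2))%C with
    ((I1 - phi 0 * RtoC (atan (r / rho))) + I2 - phi 0 * RtoC (PI / 2 - atan (r / rho)))%C
    by (rewrite RtoC_minus; ring).
  eapply Rle_trans; [apply Cmod_triangle_minus|].
  pose proof (Cmod_triangle (I1 - phi 0 * RtoC (atan (r / rho))) I2). lra.
- assert (Hbeta : exists beta, 0 < beta < r /\ Cmod (Y beta) = rho).
  { destruct (IVT_gen (fun u => Cmod (Y u)) 0 r rho) as [beta [B1 B2]].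
    - intros u. apply continuity_pt_filterlim. apply (contRC_Cmod Y u), CY.
    - rewrite Y0, Cmod_0. pose proof (Hmb r ltac:(lra)). rewrite Rmin_left, Rmax_right; lra.
    - rewrite Rmin_left, Rmax_right in B1 by lra. exists beta. split; [|exact B2].
      assert (beta <> 0) by (intros ->; rewrite Y0, Cmod_0 in B2; lra).
      assert (beta <> r) by (intros ->; pose proof (Hmb r ltac:(lra)); lra). lra. }
  destruct Hbeta as [beta [Hbeta Ebeta]].
  assert (CG : forall u, 0 < u <= b -> contRC (fun u => phi u * / Y u)%C u).
  { intros u Hu. apply contRC_mult; [apply Cphi|]. apply contRC_inv; [apply CY | apply Hne; lra]. }
  assert (HG : intRC (fun u => phi u * / Y u)%C beta b
     (RInt (V := C_R_CompleteNormedModule) (fun u => phi u * / Y u)%C beta b)).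
  { apply intRC_cont. rewrite Rmin_left, Rmax_right by lra. intros u Hu. apply CG; lra. }
  set (J := RInt (V := C_R_CompleteNormedModule) (fun u => phi u * / Y u)%C beta b) in *.
  clearbody J.
  exists J. split.
  + replace J with (RtoC 0 + J)%C by ring. apply intRC_Chasles with beta.
    * apply intRC_ext with (fun _ => RtoC 0); [lra| |apply intRC_zero].
      intros u Hu. destruct (Rle_dec rho (Cmod (Y u))) as [L|L]; [|reflexivity].
      pose proof (Hmono u beta ltac:(lra) ltac:(lra)). lra.
    * apply intRC_ext with (3 := HG); [lra|].
      intros u Hu. destruct (Rle_dec rho (Cmod (Y u))) as [L|L]; [reflexivity|].
      exfalso. apply L. destruct (Rle_dec u r).
      -- pose proof (Hmono beta u ltac:(lra) ltac:(lra)). lra.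
      -- pose proof (Hmb u ltac:(lra)). lra.
  + intros I HI.
    destruct (intRC_split _ 0 beta b I ltac:(lra) HI) as [A1 [A' [H1 [H' ->]]]].
    destruct (intRC_split _ beta r b A' ltac:(lra) H') as [A2 [A3 [H2 [H3 ->]]]].
    destruct (intRC_split _ beta r b J ltac:(lra) HG) as [B2 [B3 [K2 [K3 ->]]]].
    clear HI H' HG.
    pose proof (Hnear beta ltac:(lra)) as Hb1.
    assert (Hb2 : (1 - e) * beta <= rho <= (1 + e) * beta).
    { assert (Eb : Cmod beta = beta) by (rewrite Cmod_R; apply Rabs_pos_eq; lra).
      pose proof (Cmod_triangle (Y beta - beta) beta) as T1.
      replace (Y beta - beta + beta)%C with (Y beta) in T1 by ring.
      pose proof (Cmod_triangle_minus (Y beta) (Y beta - beta)) as T2.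
      replace (Y beta - (Y beta - beta))%C with (RtoC beta) in T2 by ring.
      rewrite Eb, Ebeta in *. lra. }
    assert (N1 := kernel_integral_near phi (fun u => conj_poisson rho (Y u))
      (fun u => u / (u * u + rho * rho)) e rho 0 beta A1 _
      ltac:(lra) Hrho ltac:(lra) (fun u Hu => Hphi u ltac:(lra))
      (fun u Hu => conj_poisson_close_inner (Y u) u e rho ltac:(nra) ltac:(lra) Hrho (Hnear u ltac:(lra))) H1
      (is_RInt_conj_inner rho beta Hrho)).
    assert (H2' : intRC (fun u => phi u * (conj_poisson rho (Y u) - / Y u))%C beta r (A2 - B2)%C).
    { apply intRC_ext with (3 := intRC_minus _ _ _ _ _ _ H2 K2); [lra|]. intros; ring. }
    assert (N2 := kernel_integral_near phi (fun u => conj_poisson rho (Y u) - / Y u)%C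
      (fun u => u / (u * u + rho * rho) - / u) e rho beta r (A2 - B2)%C _
      ltac:(lra) Hrho ltac:(lra) (fun u Hu => Hphi u ltac:(lra))
      (fun u Hu => conj_poisson_close_outer (Y u) u e rho ltac:(nra) ltac:(lra) Hrho (Hnear u ltac:(lra))) H2'
      (is_RInt_conj_outer rho beta r Hrho ltac:(lra))).
    assert (N3 : Cmod (A3 - B3) <= eps / 4).
    { apply Rle_trans with ((b - r) * (M * (rho * / (m ^ 2 / 2)))).
      - apply (intRC_bound_const _ _ _ _ _ Hrb) with (2 := intRC_minus _ _ _ _ _ _ H3 K3). intros u Hu.
        pose proof (Hmb u Hu) as Hmu. simpl in Hmu.
        pose proof (denominator_away_from_0 (Y u) m rho (conj Hm Hmu) (conj Hrho Hc1)) as HD.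
        assert (Nu : Y u <> 0) by (apply Hne; lra).
        replace (phi u * conj_poisson rho (Y u) - phi u * / Y u)%C with
          (phi u * (- RtoC (rho * rho) / (Y u * (Y u * Y u + RtoC (rho * rho)))))%C.
        2: { unfold conj_poisson. field. split; [exact Nu | apply Hden; lra]. }
        rewrite Cmod_mult. apply Rmult_le_compat; try apply Cmod_ge_0; [apply HMb; lra|].
        apply Rle_trans with (rho * rho / (m * (m ^ 2 / 2))).
        + apply Cmod_div_le; [apply Rmult_lt_0_compat; nra| |].
          * rewrite Cmod_opp, Cmod_R, Rabs_pos_eq; nra.
          * rewrite Cmod_mult. apply Rmult_le_compat; nra.
        + replace (rho * rho / (m * (m ^ 2 / 2))) with (rho / m * (rho * / (m ^ 2 / 2))) by (field; lra).
          rewrite <- (Rmult_1_l (rho * / (m ^ 2 / 2))) at 2. apply Rmult_le_compat_r.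
          * apply Rmult_le_pos; [lra|]. apply Rlt_le, Rinv_0_lt_compat; nra.
          * apply (Rmult_le_reg_r m); [lra|]. replace (rho / m * m) with rho by (field; lra). lra.
      - eapply Rle_trans; [|exact Hfar]. apply Rmult_le_compat_r; [|lra].
        apply Rmult_le_pos; [lra|]. apply Rmult_le_pos; [lra|]. apply Rlt_le, Rinv_0_lt_compat; nra. }
    pose proof (truncated_conj_mass_small rho beta r e Hrho ltac:(lra) ltac:(lra) Hb2 ltac:(nra)) as N4.
    set (J1 := / 2 * ln (beta * beta + rho * rho) - ln rho) in *.
    set (J2 := / 2 * ln (r * r + rho * rho) - ln r - (/ 2 * ln (beta * beta + rho * rho) - ln beta)) in *.
    fold p0 in N1, N2. fold k in N1, N2.
    assert (N5 : Cmod (phi 0 * RtoC (J1 + J2)) <= p0 * (3 * e)).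
    { rewrite Cmod_mult, Cmod_R. fold p0. apply Rmult_le_compat_l; assumption. }
    assert (p0 * (3 * e) <= e * k) by (unfold k; nra).
    replace (A1 + (A2 + A3) - (B2 + B3))%C with
      ((A1 - phi 0 * RtoC J1) + (A2 - B2 - phi 0 * RtoC J2) + ((A3 - B3) + phi 0 * RtoC (J1 + J2)))%C
      by (rewrite RtoC_plus; ring).
    eapply Rle_trans; [apply Cmod_triangle|].
    pose proof (Cmod_triangle (A1 - phi 0 * RtoC J1) (A2 - B2 - phi 0 * RtoC J2)).
    pose proof (Cmod_triangle (A3 - B3) (phi 0 * RtoC (J1 + J2))). lra.
Qed.

Lemma intRC_opp (f : R -> C) a b (I : C) : intRC f a b I -> intRC (fun s => - f s)%C a b (- I)%C.
Proof. exact (is_RInt_opp (V := C_R_NormedModule) f a b I). Qed.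

Lemma intRC_reflect (f : R -> C) a b (I : C) : a <= b ->
  intRC f (- b) (- a) I -> intRC (fun u => f (- u)) a b I.
Proof.
intros Hab H.
assert (A := is_RInt_swap (V := C_R_NormedModule) f _ _ _ H).
apply (is_RInt_comp_opp (V := C_R_NormedModule)) in A.
apply intRC_opp in A. replace I with (- (opp (G := C_R_NormedModule) I))%C.
- apply intRC_ext with (3 := A); [lra|]. intros s _. change ((- - f (- s)%R)%C = f (- s)%R). ring.
- change ((- - I)%C = I). ring.
Qed.

Lemma intRC_translate (f : R -> C) t a b (I : C) : a <= b ->
  intRC f (a + t) (b + t) I -> intRC (fun u => f (u + t)) a b I.
Proof.
intros Hab H.
assert (A : intRC f (1 * a + t) (1 * b + t) I) by (rewrite !Rmult_1_l; exact H).
apply (is_RInt_comp_lin (V := C_R_NormedModule)) in A.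
apply intRC_ext with (3 := A); [lra|]. intros s _.
rewrite Rmult_1_l. exact (scal_one (V := C_R_NormedModule) (f (s + t))).
Qed.

(** Moves the point of interest to the middle of the interval of integration, away
    from the base point of the parametrization. *)
Lemma intRC_period_window (f : R -> C) T s0 (I : C) :
  - (T / 2) <= s0 <= T / 2 -> (forall s, f (s + T) = f s) ->
  (intRC f 0 T I <-> intRC (fun u => f (u + s0)) (- (T / 2)) (T / 2) I).
Proof.
intros Hs HT.
assert (Hm : forall a b J, a <= b -> intRC f (a + T) (b + T) J -> intRC f a b J).
{ intros a b J Hab H. apply intRC_translate in H; [|exact Hab].
  apply intRC_ext with (3 := H); [exact Hab|]. intros; apply HT. }
assert (HT' : forall s, f (s + - T) = f s) by (intros s; rewrite <- HT; f_equal; ring).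
assert (Hp : forall a b J, a <= b -> intRC f a b J -> intRC f (a + T) (b + T) J).
{ intros a b J Hab H. replace a with ((a + T) + - T) in H by ring. replace b with ((b + T) + - T) in H by ring.
  apply intRC_translate in H; [|lra].
  apply intRC_ext with (3 := H); [lra|]. intros; apply HT'. }
split; intros H.
- apply intRC_translate; [lra|].
  destruct (intRC_split f 0 (s0 + T / 2) T I) as [I1 [I2 [H1 [H2 ->]]]]; [lra|exact H|].
  rewrite Cplus_comm. apply intRC_Chasles with 0.
  + apply Hm; [lra|]. replace (- (T / 2) + s0 + T) with (s0 + T / 2) by field.
    rewrite Rplus_0_l. exact H2.
  + replace (T / 2 + s0) with (s0 + T / 2) by ring. exact H1.
- assert (H' : intRC f (- (T / 2) + s0) (T / 2 + s0) I).
  { assert (A : intRC (fun u => f (u + s0)) ((- (T/2) + s0) + - s0) ((T / 2 + s0) + - s0) I).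
    { replace (- (T/2) + s0 + - s0) with (- (T/2)) by ring. replace (T/2 + s0 + - s0) with (T/2) by ring. exact H. }
    apply intRC_translate in A; [|lra].
    apply intRC_ext with (3 := A); [lra|]. intros; f_equal; ring. }
  destruct (intRC_split f (- (T / 2) + s0) 0 (T / 2 + s0) I ltac:(lra) H') as [I1 [I2 [H1 [H2 ->]]]].
  rewrite Cplus_comm. apply intRC_Chasles with (T / 2 + s0); [exact H2|].
  apply Hp in H1; [|lra]. replace (- (T / 2) + s0 + T) with (T / 2 + s0) in H1 by field.
  rewrite Rplus_0_l in H1. exact H1.
Qed.

Lemma contRC_cpoisson Y phi rho u : contRC Y u -> contRC phi u ->
  (Y u * Y u + RtoC (rho * rho))%C <> 0 -> contRC (fun u => phi u * cpoisson rho (Y u))%C u.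
Proof.
intros A B D. apply contRC_mult; [exact B|]. apply contRC_mult; [apply contRC_const|].
apply contRC_inv; [|exact D]. apply contRC_plus; [|apply contRC_const]. now apply contRC_mult.
Qed.

Lemma contRC_cconj Y phi rho u : contRC Y u -> contRC phi u ->
  (Y u * Y u + RtoC (rho * rho))%C <> 0 -> contRC (fun u => phi u * conj_poisson rho (Y u))%C u.
Proof.
intros A B D. apply contRC_mult; [exact B|]. apply contRC_mult; [exact A|].
apply contRC_inv; [|exact D]. apply contRC_plus; [|apply contRC_const]. now apply contRC_mult.
Qed.

(** The left half is the right half of [- Y (- u)], which again has strict
    derivative [1] at [0]; the Poisson kernel is even and its conjugate odd. *)
Lemma two_sided_limits (Y phi : R -> C) (b : R) : 0 < b ->
  (forall u, contRC Y u) -> (forall u, contRC phi u) -> Y 0 = RtoC 0 ->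
  (forall e, 0 < e -> exists r, 0 < r /\ forall u v, - r <= u <= v -> v <= r ->
     Cmod (Y v - Y u - RtoC (v - u)) <= e * (v - u)) ->
  (forall u, - b <= u <= b -> u <> 0 -> Y u <> RtoC 0) ->
  forall eps, 0 < eps -> exists rho0, 0 < rho0 /\ forall rho, 0 < rho < rho0 ->
  (forall u, - b <= u <= b -> (Y u * Y u + RtoC (rho * rho))%C <> 0) /\
  (exists I, intRC (fun u => phi u * cpoisson rho (Y u))%C (- b) b I /\
     Cmod (I - phi 0 * RtoC PI) <= eps) /\
  exists I J, intRC (fun u => phi u * conj_poisson rho (Y u))%C (- b) b I /\
  intRC (fun u => if Rle_dec rho (Cmod (Y u)) then (phi u * / Y u)%C else RtoC 0) (- b) b J /\
     Cmod (I - J) <= eps.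
Proof.
intros Hb CY Cphi Y0 HS Hne eps Heps.
assert (Copp : forall u, continuous (fun u : R => - u) u).
{ intros u. apply (continuous_opp (V := R_NormedModule)), continuous_id. }
destruct (one_sided_limits Y phi b Hb CY Cphi Y0) with (eps := eps / 2) as [r1 [Hr1 H1]].
{ intros e He. destruct (HS e He) as [r [Hr H]]. exists r. split; [exact Hr|]. intros; apply H; lra. }
{ intros u Hu. apply Hne; lra. }
{ lra. }
destruct (one_sided_limits (fun u => - Y (- u)%R)%C (fun u => phi (- u)) b Hb) with (eps := eps / 2) as [r2 [Hr2 H2]].
{ intros u. apply (continuous_opp (V := C_R_NormedModule)).
  apply (continuous_comp (V := R_UniformSpace) Ropp Y u); [apply Copp | apply CY]. }
{ intros u. apply (continuous_comp (V := R_UniformSpace) Ropp phi u); [apply Copp | apply Cphi]. }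
{ rewrite Ropp_0, Y0. ring. }
{ intros e He. destruct (HS e He) as [r [Hr H]]. exists r. split; [exact Hr|]. intros u v Huv Hv.
  replace (- Y (- v)%R - - Y (- u)%R - (v - u)%R)%C with (Y (- u)%R - Y (- v)%R - RtoC (- u - - v))%C
    by (rewrite !RtoC_minus, !RtoC_opp; ring).
  replace (v - u) with (- u - - v) by ring. apply H; lra. }
{ intros u Hu E. apply (Hne (- u)); [lra|lra|]. replace (Y (- u)) with (- - Y (- u)%R)%C by ring. rewrite E. ring. }
{ lra. }
exists (Rmin r1 r2). split; [now apply Rmin_pos|]. intros rho Hrho.
pose proof (Rmin_l r1 r2). pose proof (Rmin_r r1 r2).
destruct (H1 rho ltac:(lra)) as [D1 [P1 [J1 [T1 K1]]]].
destruct (H2 rho ltac:(lra)) as [D2 [P2 [J2 [T2 K2]]]]. clear H1 H2.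
assert (D : forall u, - b <= u <= b -> (Y u * Y u + RtoC (rho * rho))%C <> 0).
{ intros u Hu. destruct (Rle_dec 0 u) as [L|L]; [apply D1; lra|].
  specialize (D2 (- u) ltac:(lra)). cbv beta in D2. rewrite Ropp_involutive in D2.
  replace (- Y u * - Y u)%C with (Y u * Y u)%C in D2 by ring. exact D2. }
split; [exact D|]. rewrite Ropp_0 in P2.
assert (HX : forall F : R -> C, (forall u, - b <= u <= b -> contRC F u) ->
  exists I1 I2, intRC F 0 b I1 /\ intRC F (- b) 0 I2 /\ intRC F (- b) b (I2 + I1)%C /\
    intRC (fun u => F (- u)) 0 b I2).
{ intros F HF.
  assert (A1 := intRC_cont F 0 b ltac:(rewrite Rmin_left, Rmax_right by lra; intros; apply HF; lra)).
  assert (A2 := intRC_cont F (- b) 0 ltac:(rewrite Rmin_left, Rmax_right by lra; intros; apply HF; lra)).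
  eexists; eexists. split; [exact A1|]. split; [exact A2|]. split.
  - now apply intRC_Chasles with 0.
  - apply intRC_reflect; [lra|]. rewrite Ropp_0. exact A2. }
split.
- destruct (HX (fun u => phi u * cpoisson rho (Y u))%C) as [I1 [I2 [A1 [A2 [A A3]]]]].
  { intros u Hu. apply contRC_cpoisson; auto. }
  exists (I2 + I1)%C. split; [exact A|].
  specialize (P1 I1 A1). specialize (P2 I2).
  assert (A4 : intRC (fun u => phi (- u)%R * cpoisson rho (- Y (- u)%R))%C 0 b I2).
  { apply intRC_ext with (3 := A3); [lra|]. intros u _. unfold cpoisson.
    replace (- Y (- u)%R * - Y (- u)%R)%C with (Y (- u)%R * Y (- u)%R)%C by ring. reflexivity. }
  specialize (P2 A4).
  replace (I2 + I1 - phi 0 * RtoC PI)%C with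
   ((I2 - phi 0 * RtoC (PI / 2)) + (I1 - phi 0 * RtoC (PI / 2)))%C.
  + eapply Rle_trans; [apply Cmod_triangle|]. lra.
  + replace (RtoC PI) with (RtoC (PI / 2) + RtoC (PI / 2))%C; [ring|].
    rewrite <- RtoC_plus. f_equal. field.
- destruct (HX (fun u => phi u * conj_poisson rho (Y u))%C) as [I1 [I2 [A1 [A2 [A A3]]]]].
  { intros u Hu. apply contRC_cconj; auto. }
  exists (I2 + I1)%C, (- J2 + J1)%C. split; [exact A|].
  specialize (K1 I1 A1). specialize (K2 (- I2)%C).
  assert (A4 : intRC (fun u => phi (- u)%R * conj_poisson rho (- Y (- u)%R))%C 0 b (- I2)%C).
  { apply intRC_ext with (3 := intRC_opp _ _ _ _ A3); [lra|]. intros u _. unfold conj_poisson, Cdiv.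
    replace (- Y (- u)%R * - Y (- u)%R)%C with (Y (- u)%R * Y (- u)%R)%C by ring. ring. }
  specialize (K2 A4). split.
  + apply intRC_Chasles with 0; [|exact T1].
    assert (B : intRC (fun u => - (if Rle_dec rho (Cmod (- Y (- - u)%R)) then phi (- - u)%R * / - Y (- - u)%R else 0))%C
       (- b) 0 (- J2)%C).
    { apply (intRC_reflect (fun u => - (if Rle_dec rho (Cmod (- Y (- u)%R)) then phi (- u)%R * / - Y (- u)%R else 0))%C); [lra|].
      rewrite Ropp_0, Ropp_involutive. apply intRC_opp. exact T2. }
    apply intRC_ext with (3 := B); [lra|]. intros u Hu. rewrite Ropp_involutive, Cmod_opp.
    destruct (Rle_dec rho (Cmod (Y u))); [|ring].
    assert (Y u <> 0) by (apply Hne; lra). field. assumption.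
  + replace (I2 + I1 - (- J2 + J1))%C with (- (- I2 - J2) + (I1 - J1))%C by ring.
    eapply Rle_trans; [apply Cmod_triangle|]. rewrite Cmod_opp. lra.
Qed.

(** * The jump relations and the principal value *)

Lemma velocity_periodic g T : simple_closed_regular g T ->
  forall s, velocity g (s + T) = velocity g s.
Proof.
intros Hc s.
assert (A := derRC_curve g T Hc (s + T)). assert (B := derRC_curve g T Hc s).
apply derRC_pair in A. apply derRC_pair in B. destruct A as [A1 A2], B as [B1 B2].
assert (S : is_derive (fun u : R => u + T) s 1) by (auto_derive; [exact I | ring]).
assert (E : forall (F : R -> R) l l', (forall u, F (u + T) = F u) ->
   is_derive F (s + T) l -> is_derive F s l' -> l = l').
{ intros F l l' HF D D'.
  assert (D2 := is_derive_comp F (fun u => u + T) s l 1 D S).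
  apply (is_derive_ext _ F) in D2; [|exact HF].
  apply is_derive_unique in D2. apply is_derive_unique in D'.
  rewrite D2 in D'. rewrite <- D'. symmetry. exact (Rmult_1_l l). }
apply injective_projections.
- apply (E (fun u => Re (g u))); auto. intros u. now rewrite (scr_closed _ _ Hc).
- apply (E (fun u => Im (g u))); auto. intros u. now rewrite (scr_closed _ _ Hc).
Qed.

Lemma curve_period_minus g T : simple_closed_regular g T -> forall s, g (s - T) = g s.
Proof. intros Hc s. rewrite <- (scr_closed _ _ Hc (s - T)). f_equal; ring. Qed.

Lemma curve_injective_on_window g T s0 u : simple_closed_regular g T -> - (T / 2) <= s0 <= T / 2 ->
  - (T / 2) <= u <= T / 2 -> u <> 0 -> g (u + s0)%R <> g s0.
Proof.
intros Hc Hs Hu Hn E. pose proof (scr_period _ _ Hc) as HT.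
assert (R : forall x, - T <= x <= T -> exists y, 0 <= y < T /\ g y = g x /\
  (y = x \/ y = x + T \/ y = x - T)).
{ intros x Hx. destruct (Rlt_dec x 0); [|destruct (Rlt_dec x T)].
  - exists (x + T). rewrite (scr_closed _ _ Hc). repeat split; auto; lra.
  - exists x. repeat split; auto; lra.
  - exists (x - T). rewrite (curve_period_minus _ _ Hc). repeat split; auto; lra. }
destruct (R (u + s0) ltac:(lra)) as [y [Hy [Ey Cy]]].
destruct (R s0 ltac:(lra)) as [y' [Hy' [Ey' Cy']]].
assert (y = y') by (apply (scr_simple _ _ Hc); auto; congruence).
destruct Cy as [->|[->| ->]], Cy' as [->|[->| ->]]; lra.
Qed.

(** Continuity of the velocity bounds the derivative of [Y u - u] near [0]. *)
Lemma strict_derivative g T s0 : simple_closed_regular g T ->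
  let Y := fun u => ((g (u + s0)%R - g s0) / velocity g s0)%C in
  forall e, 0 < e -> exists r, 0 < r /\ forall u v, - r <= u <= v -> v <= r ->
     Cmod (Y v - Y u - RtoC (v - u)) <= e * (v - u).
Proof.
intros Hc Y e He. set (a := velocity g s0).
assert (Na : a <> 0) by apply (scr_regular _ _ Hc).
assert (Ha : 0 < Cmod a) by now apply Cmod_gt_0.
assert (Cs : forall u, continuous (fun u : R => u + s0) u).
{ intros u. apply continuity_pt_filterlim. reg. }
assert (CV : forall u, contRC (fun u => velocity g (u + s0)%R) u).
{ intros u. apply (continuous_comp (V := R_UniformSpace) (fun u : R => u + s0) (velocity g) u); [apply Cs|].
  apply (scr_C1 _ _ Hc). }
destruct (proj1 (contRC_eps _ 0) (CV 0) (e * Cmod a)) as [r [Hr H]]; [nra|].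
rewrite Rplus_0_l in H. fold a in H.
exists (r / 2). split; [lra|]. intros u v Huv Hv.
assert (I1 : intRC (fun t => velocity g (t + s0)) u v (g (v + s0)%R - g (u + s0)%R)%C).
{ apply (intRC_translate (velocity g) s0); [lra|].
  apply intRC_FTC; intros s _; [now apply (derRC_curve g T) | apply (scr_C1 _ _ Hc)]. }
assert (I2 : intRC (fun _ => a) u v (RtoC (v - u) * a)%C).
{ replace (RtoC (v - u) * a)%C with (RtoC v * a - RtoC u * a)%C by (rewrite RtoC_minus; ring).
  apply (intRC_FTC (fun t => RtoC t * a)%C); intros s _; [|apply contRC_const].
  assert (D : derRC (fun t => RtoC t) s (RtoC 1)).
  { apply derRC_pair. simpl. split; auto_derive; trivial; ring. }
  assert (E := derRC_mult _ _ s _ _ D (derRC_const a s)). cbv beta in E.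
  replace (1 * a + s * 0)%C with a in E by ring. exact E. }
assert (B : Cmod (g (v + s0)%R - g (u + s0)%R - RtoC (v - u) * a) <= (v - u) * (e * Cmod a)).
{ apply (intRC_bound_const _ _ u v _ (proj2 Huv)) with (2 := intRC_minus _ _ _ _ _ _ I1 I2).
  intros s Hs. apply Rlt_le, H. rewrite Rminus_0_r. apply Rabs_def1; lra. }
unfold Y. fold a.
replace ((g (v + s0)%R - g s0) / a - (g (u + s0)%R - g s0) / a - (v - u)%R)%C
 with ((g (v + s0)%R - g (u + s0)%R - RtoC (v - u) * a) / a)%C by (field; exact Na).
rewrite Cmod_div by exact Na. apply (Rmult_le_reg_r (Cmod a)); [exact Ha|].
unfold Rdiv. rewrite Rmult_assoc, Rinv_l by lra. lra.
Qed.

(** With [Y = (g (u + s0) - z)/a] one has [g - wp = a (Y - i rho)] and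
    [g - wm = a (Y + i rho)], so the sum and the difference of the two Cauchy
    kernels are multiples of the conjugate Poisson and the Poisson kernel at
    [Y]. *)
Lemma jump_on_curve g T (phi : R -> C) s0 :
  simple_closed_regular g T -> - (T / 2) <= s0 <= T / 2 ->
  (forall s, contRC phi s) -> (forall s, phi (s + T) = phi s) ->
  let a := velocity g s0 in let z := g s0 in
  forall eps, 0 < eps -> exists rho0, 0 < rho0 /\ forall rho, 0 < rho < rho0 ->
  let wp := (z + Ci * a * rho)%C in let wm := (z - Ci * a * rho)%C in
  ~ on_curve g T wp /\ ~ on_curve g T wm /\
  Cmod (cauchy_integral g T phi wp - cauchy_integral g T phi wm
        - RtoC (2 * PI) * Ci * (phi s0 / a)) <= eps /\
  exists J,
    intRC (fun s => if Rle_dec (Cmod a * rho) (Cmod (g s - z)) then (phi s / (g s - z))%C else RtoC 0) 0 T J /\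
    Cmod (cauchy_integral g T phi wp + cauchy_integral g T phi wm - 2 * J) <= eps.
Proof.
intros Hc Hs0 Cphi Pphi a z eps Heps. pose proof (scr_period _ _ Hc) as HT.
assert (Na : a <> 0) by apply (scr_regular _ _ Hc).
assert (Ha : 0 < Cmod a) by now apply Cmod_gt_0.
assert (Cs : forall u, continuous (fun u : R => u + s0) u).
{ intros u. apply continuity_pt_filterlim. reg. }
set (Y := fun u => ((g (u + s0)%R - z) / a)%C).
assert (CY : forall u, contRC Y u).
{ intros u. apply contRC_mult; [|apply contRC_const]. apply contRC_minus; [|apply contRC_const].
  apply (continuous_comp (V := R_UniformSpace) (fun u : R => u + s0) g u); [apply Cs|]. now apply (contRC_curve g T). }
assert (Cp : forall u, contRC (fun u => phi (u + s0)) u).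
{ intros u. apply (continuous_comp (V := R_UniformSpace) (fun u : R => u + s0) phi u); [apply Cs | apply Cphi]. }
assert (HgY : forall u, g (u + s0)%R = (z + a * Y u)%C).
{ intros u. unfold Y. field. exact Na. }
destruct (two_sided_limits Y (fun u => phi (u + s0)) (T / 2)) with (eps := eps * Cmod a / 2)
  as [rho0 [Hrho0 H]]; auto.
{ lra. }
{ unfold Y, z. rewrite Rplus_0_l. field. exact Na. }
{ exact (strict_derivative g T s0 Hc). }
{ intros u Hu Hn E. apply (curve_injective_on_window g T s0 u Hc Hs0 Hu Hn). rewrite HgY, E. unfold z. ring. }
{ apply Rdiv_lt_0_compat; nra. }
exists rho0. split; [exact Hrho0|]. intros rho Hrho wp wm.
destruct (H rho Hrho) as [HD [[Ip [HIp Bp]] [Iq [J [HIq [HJ Bq]]]]]]. clear H. rewrite Rplus_0_l in Bp.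
assert (F : forall u, - (T / 2) <= u <= T / 2 -> (Y u - Ci * rho)%C <> 0 /\ (Y u + Ci * rho)%C <> 0).
{ intros u Hu. specialize (HD u Hu).
  replace (Y u * Y u + (rho * rho)%R)%C with ((Y u - Ci * rho) * (Y u + Ci * rho))%C in HD.
  - split; intros E; apply HD; rewrite E; ring.
  - rewrite RtoC_mult. assert (Ci * Ci = -1)%C by (apply injective_projections; simpl; ring).
    replace ((Y u - Ci * rho) * (Y u + Ci * rho))%C with (Y u * Y u - (Ci * Ci) * (rho * rho))%C by ring.
    rewrite H. ring. }
assert (W : forall s, 0 <= s <= T -> exists u, - (T / 2) <= u <= T / 2 /\ g (u + s0)%R = g s).
{ intros s Hs. destruct (Rle_dec (s - s0) (T / 2)).
  - exists (s - s0). split; [lra|]. f_equal; ring.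
  - exists (s - s0 - T). split; [lra|]. replace (s - s0 - T + s0) with (s - T) by ring.
    now apply curve_period_minus. }
assert (Op : ~ on_curve g T wp).
{ intros [s [Hs E]]. destruct (W s Hs) as [u [Hu Eu]]. apply (proj1 (F u Hu)).
  rewrite <- Eu, HgY in E. unfold wp in E.
  replace (Y u - Ci * rho)%C with ((z + a * Y u - (z + Ci * a * rho)) / a)%C by (field; exact Na).
  rewrite E. field. exact Na. }
assert (Om : ~ on_curve g T wm).
{ intros [s [Hs E]]. destruct (W s Hs) as [u [Hu Eu]]. apply (proj2 (F u Hu)).
  rewrite <- Eu, HgY in E. unfold wm in E.
  replace (Y u + Ci * rho)%C with ((z + a * Y u - (z - Ci * a * rho)) / a)%C by (field; exact Na).
  rewrite E. field. exact Na. }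
split; [exact Op|]. split; [exact Om|].
assert (Cg : forall s, 0 <= s <= T -> contRC g s) by (intros; now apply (contRC_curve g T)).
assert (Ap := cauchy_integral_correct g T phi wp ltac:(lra) Cg (fun s _ => Cphi s) Op).
assert (Am := cauchy_integral_correct g T phi wm ltac:(lra) Cg (fun s _ => Cphi s) Om).
apply (intRC_period_window _ T s0 _ Hs0) in Ap; [|intros s; now rewrite Pphi, (scr_closed _ _ Hc)].
apply (intRC_period_window _ T s0 _ Hs0) in Am; [|intros s; now rewrite Pphi, (scr_closed _ _ Hc)].
set (Kp := cauchy_integral g T phi wp) in *. set (Km := cauchy_integral g T phi wm) in *.
assert (Kd : forall u, - (T / 2) <= u <= T / 2 ->
   (g (u + s0)%R - wp)%C = (a * (Y u - Ci * rho))%C /\ (g (u + s0)%R - wm)%C = (a * (Y u + Ci * rho))%C).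
{ intros u Hu. rewrite HgY. unfold wp, wm. split; ring. }
assert (Ci2 : (Ci * Ci = -1)%C) by (apply injective_projections; simpl; ring).
assert (Prod : forall u, (Y u * Y u + (rho * rho)%R)%C = ((Y u - Ci * rho) * (Y u + Ci * rho))%C).
{ intros u. rewrite RtoC_mult.
  replace ((Y u - Ci * rho) * (Y u + Ci * rho))%C with (Y u * Y u - (Ci * Ci) * (rho * rho))%C by ring.
  rewrite Ci2. ring. }
split.
- assert (E : (Kp - Km = 2 * Ci / a * Ip)%C).
  { apply (intRC_unique (fun u => 2 * Ci / a * (phi (u + s0)%R * cpoisson rho (Y u)))%C (- (T/2)) (T/2)).
    - apply intRC_ext with (3 := intRC_minus _ _ _ _ _ _ Ap Am); [lra|]. intros u Hu.
      destruct (Kd u ltac:(lra)) as [-> ->]. destruct (F u ltac:(lra)) as [F1 F2].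
      unfold cpoisson. rewrite Prod. field. repeat split; assumption.
    - now apply intRC_scal. }
  rewrite E. replace (2 * Ci / a * Ip - (2 * PI)%R * Ci * (phi s0 / a))%C
    with (2 * Ci / a * (Ip - phi s0 * PI))%C by (rewrite RtoC_mult; field; exact Na).
  rewrite Cmod_mult, Cmod_div, Cmod_mult, Cmod_Ci, Cmod_R, Rabs_pos_eq by (assumption || lra).
  apply Rle_trans with (2 * 1 / Cmod a * (eps * Cmod a / 2)); [|right; field; lra].
  apply Rmult_le_compat_l; [|exact Bp]. apply Rlt_le, Rdiv_lt_0_compat; lra.
- assert (E : (Kp + Km = 2 / a * Iq)%C).
  { apply (intRC_unique (fun u => 2 / a * (phi (u + s0)%R * conj_poisson rho (Y u)))%C (- (T/2)) (T/2)).
    - apply intRC_ext with (3 := intRC_plus _ _ _ _ _ _ Ap Am); [lra|]. intros u Hu.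
      destruct (Kd u ltac:(lra)) as [-> ->]. destruct (F u ltac:(lra)) as [F1 F2].
      unfold conj_poisson. rewrite Prod. field. repeat split; assumption.
    - now apply intRC_scal. }
  exists (/ a * J)%C. split.
  + apply (intRC_period_window _ T s0 _ Hs0).
    { intros s. now rewrite Pphi, (scr_closed _ _ Hc). }
    apply intRC_ext with (3 := intRC_scal (/ a) _ _ _ _ HJ); [lra|]. intros u Hu.
    assert (EY : (g (u + s0)%R - z)%C = (a * Y u)%C) by (rewrite HgY; ring).
    rewrite EY, Cmod_mult.
    destruct (Rle_dec rho (Cmod (Y u))) as [L|L], (Rle_dec (Cmod a * rho) (Cmod a * Cmod (Y u))) as [L'|L'].
    * assert (Y u <> 0) by (apply Cmod_pos_neq_0; lra). field. split; assumption.
    * elim L'. apply Rmult_le_compat_l; lra.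
    * elim L. apply Rmult_le_reg_l with (1 := Ha) (2 := L').
    * ring.
  + rewrite E. replace (2 / a * Iq - 2 * (/ a * J))%C with (2 / a * (Iq - J))%C by (field; exact Na).
    rewrite Cmod_mult, Cmod_div, Cmod_R, Rabs_pos_eq by (assumption || lra).
    apply Rle_trans with (2 / Cmod a * (eps * Cmod a / 2)); [|right; field; lra].
    apply Rmult_le_compat_l; [|exact Bq]. apply Rlt_le, Rdiv_lt_0_compat; lra.
Qed.

Lemma winding_cauchy g T z : winding_number g T z =
  (/ (RtoC (2 * PI) * Ci) * cauchy_integral g T (velocity g) z)%C.
Proof.
unfold winding_number. f_equal. apply (RInt_ext (V := C_R_CompleteNormedModule)). intros s _.
change ((/ (g s - z) * velocity g s)%C = (velocity g s / (g s - z))%C).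
unfold Cdiv. ring.
Qed.

Lemma two_pi_i_neq_0 : (RtoC (2 * PI) * Ci)%C <> 0.
Proof.
pose proof PI_RGT_0. apply Cmod_pos_neq_0. rewrite Cmod_mult, Cmod_Ci, Cmod_R, Rabs_pos_eq; lra.
Qed.

(** The jump of the winding integral is [2 pi i] up to an error of [1], while each
    of the two values is [0] or [2 pi i] according to the side: only one of the
    four combinations is possible. *)
Lemma sides_of_curve g T s0 : simple_closed_regular g T -> counterclockwise g T ->
  - (T / 2) <= s0 <= T / 2 ->
  exists rho0, 0 < rho0 /\ forall rho, 0 < rho < rho0 ->
  interior_domain g T (g s0 + Ci * velocity g s0 * rho)%C /\
  exterior_domain g T (g s0 - Ci * velocity g s0 * rho)%C.
Proof.
intros Hc Hccw Hs0.
destruct (jump_on_curve g T (velocity g) s0 Hc Hs0 (scr_C1 _ _ Hc) (velocity_periodic g T Hc) 1 Rlt_0_1)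
  as [rho0 [Hrho0 H]].
exists rho0. split; [exact Hrho0|]. intros rho Hrho.
destruct (H rho Hrho) as [Op [Om [Hj _]]]. clear H.
assert (Na : velocity g s0 <> 0) by apply (scr_regular _ _ Hc).
replace (velocity g s0 / velocity g s0)%C with (RtoC 1) in Hj by (field; exact Na).
set (wp := (g s0 + Ci * velocity g s0 * rho)%C) in *. set (wm := (g s0 - Ci * velocity g s0 * rho)%C) in *.
assert (Wi : forall w, interior_domain g T w -> cauchy_integral g T (velocity g) w = (RtoC (2 * PI) * Ci)%C).
{ intros w Hw. specialize (Hccw w Hw). rewrite winding_cauchy in Hccw.
  replace (cauchy_integral g T (velocity g) w) with
    (RtoC (2 * PI) * Ci * (/ (RtoC (2 * PI) * Ci) * cauchy_integral g T (velocity g) w))%C.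
  - rewrite Hccw. ring.
  - rewrite Cmult_assoc, Cinv_r by exact two_pi_i_neq_0. ring. }
(* in the three impossible cases the left side of [Hj] is [-1] or [-2] times
   [2 pi i], while [2 pi > 1] *)
assert (Big : forall c : C, 1 <= Cmod c -> Cmod (c * (RtoC (2 * PI) * Ci)) <= 1 -> False).
{ intros c Hc1. rewrite !Cmod_mult, Cmod_Ci, Cmod_R. pose proof PI2_3_2. rewrite Rabs_pos_eq by lra. nra. }
assert (M1 : Cmod (-1) = 1) by (rewrite Cmod_R, Rabs_left; lra).
assert (M2 : Cmod (-2) = 2) by (rewrite Cmod_R, Rabs_left; lra).
destruct (classic (bounded_component g T wp)) as [Bp|Bp], (classic (bounded_component g T wm)) as [Bm|Bm].
- exfalso. rewrite (Wi wp), (Wi wm) in Hj by (split; assumption).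
  apply (Big (-1)); [lra|].
  replace (-1 * (RtoC (2 * PI) * Ci))%C with (RtoC (2 * PI) * Ci - RtoC (2 * PI) * Ci - RtoC (2 * PI) * Ci * 1)%C by ring. exact Hj.
- split; split; assumption.
- exfalso. rewrite (winding_exterior g T wp), (Wi wm) in Hj by (assumption || (split; assumption)).
  apply (Big (-2)); [lra|].
  replace (-2 * (RtoC (2 * PI) * Ci))%C with (0 - RtoC (2 * PI) * Ci - RtoC (2 * PI) * Ci * 1)%C by ring. exact Hj.
- exfalso. rewrite (winding_exterior g T wp), (winding_exterior g T wm) in Hj by (assumption || (split; assumption)).
  apply (Big (-1)); [lra|].
  replace (-1 * (RtoC (2 * PI) * Ci))%C with (0 - 0 - RtoC (2 * PI) * Ci * 1)%C by ring. exact Hj.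
Qed.

Lemma curve_everywhere g T s : simple_closed_regular g T -> on_curve g T (g s).
Proof.
intros Hc. pose proof (scr_period _ _ Hc) as HT.
assert (Hk : forall k s, g (s + IZR k * T) = g s).
{ apply (Z.bi_induction (fun k => forall s, g (s + IZR k * T) = g s)).
  - now intros ? ? ->.
  - intros t. f_equal. ring.
  - intros k. assert (E : forall t, g (t + IZR (Z.succ k) * T) = g (t + IZR k * T)).
    { intros t. rewrite succ_IZR, <- (scr_closed _ _ Hc (t + IZR k * T)). f_equal. ring. }
    split; intros H t; [rewrite E | rewrite <- E]; apply H. }
exists (s + IZR (- Int_part (s / T)) * T). split; [|apply Hk].
destruct (base_Int_part (s / T)) as [B1 B2]. rewrite opp_IZR.
replace (s + - IZR (Int_part (s / T)) * T) with ((s / T - IZR (Int_part (s / T))) * T) by (field; lra).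
split; nra.
Qed.

(** The sum of the Cauchy integrals at the two normal points is
    [2 pi i h(wp) + 0], and it is asymptotically twice the truncated integral. *)
Lemma principal_value_of_reproduced g T (h : C -> C) z :
  simple_closed_regular g T -> counterclockwise g T ->
  (forall z, on_curve g T z -> contCC h z) -> cauchy_reproduced g T h -> on_curve g T z ->
  is_contour_PV g T (fun t => h t / (t - z))%C z (RtoC PI * Ci * h z)%C.
Proof.
intros Hc Hccw Hh [Hi He] Hz. pose proof (scr_period _ _ Hc) as HT.
assert (Hs : exists s0, - (T / 2) <= s0 <= T / 2 /\ g s0 = z).
{ destruct Hz as [s [Hs E]]. destruct (Rle_dec s (T / 2)).
  - exists s. split; [lra|exact E].
  - exists (s - T). split; [lra|]. now rewrite (curve_period_minus g T Hc). }
destruct Hs as [s0 [Hs0 Es0]].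
set (phi := fun s => (h (g s) * velocity g s)%C).
assert (Cphi : forall s, contRC phi s).
{ intros s. apply contRC_mult; [|apply (scr_C1 _ _ Hc)].
  apply (continuous_comp (V := C_UniformSpace) g h); [now apply (contRC_curve g T)|].
  now apply Hh, curve_everywhere. }
assert (Pphi : forall s, phi (s + T) = phi s).
{ intros s. unfold phi. now rewrite (velocity_periodic g T Hc), (scr_closed _ _ Hc). }
set (a := velocity g s0). assert (Na : a <> 0) by apply (scr_regular _ _ Hc).
assert (Ha : 0 < Cmod a) by now apply Cmod_gt_0.
intros P HP. apply locally_Cmod in HP. destruct HP as [eps [Heps HP]].
destruct (jump_on_curve g T phi s0 Hc Hs0 Cphi Pphi eps Heps) as [r1 [Hr1 H1]].
destruct (sides_of_curve g T s0 Hc Hccw Hs0) as [r2 [Hr2 H2]].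
fold a in H1, H2. rewrite Es0 in H1, H2.
destruct (proj1 (contCC_eps h z) (Hh z Hz) (eps / 8)) as [d [Hd H3]]; [lra|].
apply (locally_Rabs 0).
exists (Rmin d (Cmod a * Rmin r1 r2)). split.
{ apply Rmin_pos; [exact Hd|]. apply Rmult_lt_0_compat; [exact Ha|]. now apply Rmin_pos. }
intros ep Hep Hpos. rewrite Rminus_0_r, Rabs_pos_eq in Hep by lra.
apply Rmin_Rgt in Hep. destruct Hep as [Hep1 Hep2].
(* truncation at [|t - z| >= ep] corresponds to the normal distance [ep] *)
set (rho := ep / Cmod a).
assert (Erho : ep = Cmod a * rho) by (unfold rho; field; lra).
assert (Hrho : 0 < rho) by (apply Rdiv_lt_0_compat; lra).
assert (Hrho2 : rho < Rmin r1 r2) by (apply (Rmult_lt_reg_l (Cmod a)); lra).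
apply Rmin_Rgt in Hrho2. destruct Hrho2 as [Hrho3 Hrho4].
destruct (H1 rho ltac:(lra)) as [_ [_ [_ [J [HJ BJ]]]]].
destruct (H2 rho ltac:(lra)) as [Wp Wm].
unfold phi in BJ. rewrite (Hi _ Wp), (He _ Wm) in BJ. clear H1 H2.
specialize (H3 (z + Ci * a * rho)%C).
replace (z + Ci * a * rho - z)%C with (Ci * a * rho)%C in H3 by ring.
rewrite !Cmod_mult, Cmod_Ci, Cmod_R, Rabs_pos_eq, Rmult_1_l in H3 by lra.
specialize (H3 ltac:(lra)).
set (hp := h (z + Ci * a * rho)%C) in *.
exists J. split.
- rewrite Erho. apply intRC_ext with (3 := HJ); [lra|]. intros s _.
  destruct (Rle_dec (Cmod a * rho) (Cmod (g s - z))); [|reflexivity].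
  unfold phi, Cdiv. ring.
- apply HP.
  replace (J - PI * Ci * h z)%C with
    (RtoC PI * Ci * (hp - h z) - / 2 * ((2 * PI)%R * Ci * hp + 0 - 2 * J))%C.
  2: { rewrite RtoC_mult. field. }
  eapply Rle_lt_trans; [apply Cmod_triangle_minus|].
  rewrite !Cmod_mult, Cmod_Ci, Cmod_inv, !Cmod_R by (intros E; apply RtoC_inj in E; lra).
  pose proof PI_4. pose proof PI_RGT_0. pose proof (Cmod_ge_0 (hp - h z)).
  rewrite (Rabs_pos_eq PI), (Rabs_pos_eq 2) by lra. nra.
Qed.

Lemma n_times_derivable (U : C -> Prop) n f k z : n_times_C_differentiable n f U ->
  (k < n)%nat -> U z -> derCC (C_derive_n f k) z (C_derive_n f (S k) z).
Proof.
intros [H _] Hk Hz. exact (C_derive_correct (C_derive_n f k) z z (H k z Hk Hz)).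
Qed.

Lemma n_times_continuous (U : C -> Prop) n f k z : n_times_C_differentiable n f U ->
  (k <= n)%nat -> U z -> contCC (C_derive_n f k) z.
Proof.
intros H Hk Hz. destruct (Nat.eq_dec k n) as [->|N].
- now apply (proj2 H).
- eapply contCC_of_derCC. apply (n_times_derivable U n f k z H); [lia | exact Hz].
Qed.

Theorem theorem8 (g : R -> C) (T : R) (n : nat) (f : C -> C)
  (Hcurve : simple_closed_regular g T)
  (Hccw : counterclockwise g T)
  (Hn : (1 <= n)%nat)
  (Hf : generalized_Cauchy_function g T n f)
  (Hint : forall z, interior_domain g T z ->
     (/ (RtoC (2 * PI) * Ci) * contour_RInt g T (fun t => f t / (t - z)))%C
     = f z)
  (Hext : forall z, exterior_domain g T z ->
     (/ (RtoC (2 * PI) * Ci) * contour_RInt g T (fun t => f t / (t - z)))%C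
     = RtoC 0)
  (Hcont : continuous_on (T := C_UniformSpace) (U := C_UniformSpace)
     (on_curve g T) (C_derive_n f n)) :
  uniformly_continuous_on (closed_domain g T) (C_derive_n f n) /\
  (forall z, on_curve g T z ->
     filterlim (C_derive_n f n)
       (within (interior_domain g T) (locally (T := C_UniformSpace) z))
       (locally (T := C_UniformSpace) (C_derive_n f n z)) /\
     exists I : C,
       is_contour_PV g T (fun t => C_derive_n f n t / (t - z))%C z I /\
       C_derive_n f n z = (/ (RtoC PI * Ci) * I)%C).
Proof.
destruct Hf as [N [_ [HN Hdiff]]].
assert (HU : forall z, closed_domain g T z -> interior_domain g T z \/ N z).
{ intros z [Hz|Hz]; [now left | right; auto]. }
assert (Hcn : forall z, closed_domain g T z -> contCC (C_derive_n f n) z).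
{ intros z Hz. apply (n_times_continuous _ n f n z Hdiff); auto. }
assert (Hpair : forall k, (k <= n)%nat -> cauchy_reproduced g T (C_derive_n f k)).
{ induction k as [|k IH]; intros Hk.
  - assert (E : forall z c, (/ (RtoC (2 * PI) * Ci) * contour_RInt g T (fun t => f t / (t - z)))%C = c ->
      cauchy_integral g T (fun s => f (g s) * velocity g s)%C z = (RtoC (2 * PI) * Ci * c)%C).
    { intros z c <-. rewrite contour_RInt_cauchy, Cmult_assoc, Cinv_r by exact two_pi_i_neq_0. ring. }
    split; intros z Hz.
    + apply E, Hint, Hz.
    + change (C_derive_n f 0) with f. rewrite (E z _ (Hext z Hz)). ring.
  - apply (reproduced_derive g T (C_derive_n f k)); auto.
    + intros z Hz. apply (n_times_derivable _ n f k z Hdiff); [lia | auto].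
    + intros z Hz. apply (n_times_continuous _ n f (S k) z Hdiff); [lia | auto].
    + apply IH; lia. }
split.
- destruct (curve_bounded g T Hcurve) as [M [HM HMb]].
  apply compact_uniformly_continuous with M; auto.
  + intros z [[_ Hz]|[s [Hs <-]]]; [|auto]. apply Rnot_lt_le. intros L.
    now apply (far_unbounded g T M z HM HMb L).
  + intros z Hz. assert (Ez : exterior_domain g T z).
    { split; intros F; apply Hz; [now right|]. left. split; [|exact F].
      intros O. apply Hz. now right. }
    destruct (exterior_open g T z Hcurve Ez) as [d [Hd H]].
    exists d. split; [exact Hd|]. intros w Hw [[_ F]|F]; destruct (H w Hw) as [A B]; auto.
- intros z Hz. split.
  + apply (filterlim_filter_le_1 (F := locally (T := C_UniformSpace) z)).
    * apply filter_le_within.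
    * apply Hcn. now right.
  + exists (RtoC PI * Ci * C_derive_n f n z)%C. split.
    * apply principal_value_of_reproduced; auto. intros w Hw. apply Hcn. now right.
    * field. split; [|apply two_pi_i_neq_0 || idtac].
      -- intros E. apply (f_equal Im) in E. simpl in E. lra.
      -- intros E. apply RtoC_inj in E. pose proof PI_RGT_0. lra.
Qed.
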